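(* Let $A$ be a C$^*$-algebra. The lower semicontinuous traces on $A_+$ agree with the lower semicontinuous monoid homomorphisms from the preCuntz semigroup $(A_+,+,0,\prec)$ to $\overline{\mathbb R}_+=[0,+\infty]$. That is, a map $t:A_+\to\overline{\mathbb R}_+$ is a lower semicontinuous trace if and only if it is a monoid homomorphism that is lower semicontinuous for the c-space topology associated with $\prec$.
   Context: $A_+=\{xx^*: x\in A\}$ is the positive cone of $A$, with order $a\le b$ iff $b-a\in A_+$. A lower semicontinuous trace is a monoid homomorphism $t:A_+\to[0,+\infty]$ (so $t(0)=0$, $t(a+b)=t(a)+t(b)$) that is lower semicontinuous for the norm topology on $A_+$ and satisfies $t(xx^* )=t(x^*x)$ for all $x\in A$. For $a\in A_+$ and $\varepsilon>0$, $(a-\varepsilon)_+$ is defined by continuous functional calculus with $s\mapsto\max(s-\varepsilon,0)$. For $a,a'\in A_+$: $a\sim a'$ if there is a sequence $(x_n)$ in $A$ with $a=\sum_n x_nx_n^*$ and $a'=\sum_n x_n^*x_n$ (norm convergent). Define $a\prec b$ iff there are $a'\in A_+$ and $\varepsilon>0$ such that $a\sim a'\le (b-\varepsilon)_+$. The c-space topology associated with $\prec$ has as open sets the sets $U\subseteq A_+$ with $U=\{x\in A_+:\exists z\in U,\ z\prec x\}$. A function into $[0,+\infty]$ is lower semicontinuous if the preimage of each $]r,+\infty]$, $r\ge 0$, is open. *)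

(* Defs.v *)
From HB Require Import structures.
From mathcomp Require Import all_boot all_order all_algebra.
From mathcomp Require Import complex.
From mathcomp Require Import all_classical all_reals all_analysis.

Set Implicit Arguments.
Unset Strict Implicit.
Unset Printing Implicit Defensive.

Import Order.TTheory GRing.Theory Num.Theory.
Import numFieldNormedType.Exports.

Local Open Scope classical_set_scope.
Local Open Scope complex_scope.
Local Open Scope ring_scope.

(* Complex C*-algebras, not necessarily unital (MathComp rings have a unit,
   so the product is part of the mixin). The norm of a normed module over
   R[i] is R[i]-valued; its values are nonnegative reals. *)
HB.mixin Record isCStarAlgebra (R : realType) A
    of CompleteNormedModule R[i] A := {
  cmul : A -> A -> A;
  star : A -> A;
  cmulA : associative cmul;
  cmulDl : left_distributive cmul +%R;
  cmulDr : right_distributive cmul +%R;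
  cmulZl : forall (l : R[i]) (x y : A), cmul (l *: x) y = l *: cmul x y;
  cmulZr : forall (l : R[i]) (x y : A), cmul x (l *: y) = l *: cmul x y;
  starK : involutive star;
  starD : {morph star : x y / x + y};
  starZ : forall (l : R[i]) (x : A), star (l *: x) = l^* *: star x;
  starM : forall x y : A, star (cmul x y) = cmul (star y) (star x);
  norm_cmul_le : forall x y : A, `|cmul x y| <= `|x| * `|y|;
  norm_star_cmul : forall x : A, `|cmul (star x) x| = `|x| ^+ 2
}.

#[short(type="cstarAlgType")]
HB.structure Definition CStarAlgebra (R : realType) :=
  { A of isCStarAlgebra R A & CompleteNormedModule R[i] A }.

Section CStar.
Context {R : realType} {A : cstarAlgType R}.
Implicit Types (a b x y : A) (f g : R[i] -> R[i]) (U : set A) (t : A -> \bar R).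

Local Notation "x ** y" := (cmul x y) (at level 40, left associativity).

Definition cpos : set A := [set x ** star x | x in [set: A]].

Definition cle a b : Prop := cpos (b - a).

(* Product of the unitization A + C.1, where (x, l) stands for x + l.1. *)
Definition umul (u v : A * R[i]) : A * R[i] :=
  (u.1 ** v.1 + u.2 *: v.1 + v.2 *: u.1, u.2 * v.2).

(* Spectrum of a in the unitization; it always contains 0. *)
Definition spectrum a : set R[i] :=
  [set l | ~ exists u, umul (- a, l) u = (0, 1) /\ umul u (- a, l) = (0, 1)].

Definition C0_spectrum a : set (R[i]^o -> R[i]^o) :=
  [set f | {within (spectrum a : set R[i]^o), continuous f} /\ f 0 = 0].

(* Phi is the functional calculus homomorphism at a: the (unique, and
   automatically contractive) *-homomorphism from the continuous functions on
   the spectrum of a that vanish at 0, mapping the identity to a. The values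
   of Phi outside C0_spectrum a are irrelevant. *)
Record is_cfc a (Phi : (R[i] -> R[i]) -> A) : Prop := {
  cfc_ext : forall f g, C0_spectrum a f -> C0_spectrum a g ->
    (forall l, spectrum a l -> f l = g l) -> Phi f = Phi g;
  cfcD : forall f g, C0_spectrum a f -> C0_spectrum a g ->
    Phi (fun l => f l + g l) = Phi f + Phi g;
  cfcZ : forall (c : R[i]) f, C0_spectrum a f ->
    Phi (fun l => c * f l) = c *: Phi f;
  cfcM : forall f g, C0_spectrum a f -> C0_spectrum a g ->
    Phi (fun l => f l * g l) = Phi f ** Phi g;
  cfc_star : forall f, C0_spectrum a f ->
    Phi (fun l => (f l)^*) = star (Phi f);
  cfc_contractive : forall f (c : R[i]), C0_spectrum a f ->
    (forall l, spectrum a l -> `|f l| <= c) -> `|Phi f| <= c;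
  cfc_id : Phi (fun l => l) = a
}.

(* f(a), for a normal and f in C0_spectrum a (0 if there is no functional
   calculus at a). *)
Definition cfc a f : A :=
  xget 0 [set b | exists Phi, is_cfc a Phi /\ b = Phi f].

(* (a - e)_+ ; the spectrum of a positive a is real. *)
Definition cutdown a (e : R) : A :=
  cfc a (fun l => (Num.max (complex.Re l - e) 0)%:C).

Definition csim a b : Prop := exists x : nat -> A,
  series (fun n => x n ** star (x n)) @ \oo --> a /\
  series (fun n => star (x n) ** x n) @ \oo --> b.

Definition prec a b : Prop := exists a' (e : R),
  [/\ cpos a', 0 < e, csim a a' & cle a' (cutdown b e)].

Definition norm_open U : Prop := open (U : set (subspace cpos)).

Definition cspace_open U : Prop :=
  U = [set x | cpos x /\ exists2 z, U z & prec z x].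

(* Maps A_+ -> [0, +oo] are represented by functions on A that are
   nonnegative on A_+; only their values on A_+ matter. *)
Definition lsc_for (is_open : set A -> Prop) t : Prop :=
  forall r : R, 0 <= r -> is_open (cpos `&` [set a | (r%:E < t a)%E]).

Definition monoid_hom t : Prop :=
  t 0 = 0%E /\ (forall a b, cpos a -> cpos b -> t (a + b) = (t a + t b)%E).

Definition lsc_trace t : Prop :=
  [/\ monoid_hom t, lsc_for norm_open t &
      forall x, t (x ** star x) = t (star x ** x)].

End CStar.

(* Main.v *)
Require Import Defs.
From HB Require Import structures.
From mathcomp Require Import all_boot all_order all_algebra.
From mathcomp Require Import complex.
From mathcomp Require Import all_classical all_reals all_analysis.
From mathcomp Require Import ssrAC ring lra.

(* If [t] is an lsc trace and [z ~ z' <= (x - e)_+], lower semicontinuity makes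
   [t] countably additive, so [t z = t z' <= t x]; conversely [(x - e)_+] is below
   [x] for the relation [prec] and converges to [x] in norm.
   If [t] is lsc for the c-space topology, then [t a] is the supremum of the
   [t ((a - e)_+)], because [z ~ z' <= (a - 2 e)_+ = ((a - e)_+ - e)_+] puts [z]
   below [(a - e)_+]; this makes transitivity of [~] unnecessary. The polar
   relation [(v v^* - e)_+ = w w^*], [(v^* v - e)_+ = w^* w] then gives the trace
   identity, and if [|y - x| <= e], then [(x - 2 e)_+ <= h y h] for a contraction
   [h], so [t ((x - 2 e)_+) <= t y] and [t] is norm lsc.
   The functional calculus is obtained in the unitization: Rickart's argument
   gives the spectral radius of a self-adjoint element, hence the norm of a
   polynomial in it, and polynomials are dense in the continuous functions on
   its spectrum. *)

Set Implicit Arguments.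
Unset Strict Implicit.
Unset Printing Implicit Defensive.

Import Order.TTheory GRing.Theory Num.Theory.
Import numFieldNormedType.Exports.

Local Open Scope classical_set_scope.
Local Open Scope complex_scope.
Local Open Scope ring_scope.

(** * Real-valued norms *)

Section RealNorm.
Context {R : realType}.

(** [cutdown] is picked by [xget] among the values of an abstract calculus [is_cfc], so it has
    content only once a calculus exists at every positive element and its values are shown to be
    forced. This is why spectral theory is developed from the axioms before any trace appears.
    Likewise [cpos] consists of the products [x x^*], and already its stability under sums rests on
    Kaplansky's theorem that [x^* x] has nonnegative spectrum. Rickart's argument asks only for
    Neumann series and for compactness of the unit circle, so neither holomorphic functions nor
    characters enter. Spectral mapping is proved for polynomials; for continuous functions the
    inclusion of [f(sp b)] in the spectrum of [f(b)], together with norm estimates, does the rest.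
    On the side of traces, the infinite sums hidden in [csim] are taken apart in a single place,
    [lsc_csim_le]. Every instance of [csim] that has to be constructed from scratch is a sum with
    one nonzero term. *)

(** The norm over [R[i]] takes complex values; its real part lives in [R], where the order is total
    and [lra] and [nra] apply. *)
Definition rnorm (V : normedZmodType R[i]) (x : V) : R := complex.Re `|x|.

Lemma rnormE (V : normedZmodType R[i]) (x : V) : `|x| = (rnorm x)%:C.
Proof. by rewrite /rnorm RRe_real // normr_real. Qed.

Lemma rnorm_ge0 (V : normedZmodType R[i]) (x : V) : 0 <= rnorm x.
Proof. by rewrite -lecR -rnormE normr_ge0. Qed.

Lemma rnorm0 (V : normedZmodType R[i]) : rnorm (0 : V) = 0.
Proof. by rewrite /rnorm normr0. Qed.

Lemma rnorm_eq0 (V : normedZmodType R[i]) (x : V) : rnorm x = 0 -> x = 0.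
Proof. by move=> x0; apply/normr0_eq0; rewrite rnormE x0. Qed.

Lemma rnormD (V : normedZmodType R[i]) (x y : V) :
  rnorm (x + y) <= rnorm x + rnorm y.
Proof. by rewrite -lecR rmorphD /= -!rnormE ler_normD. Qed.

Lemma rnormN (V : normedZmodType R[i]) (x : V) : rnorm (- x) = rnorm x.
Proof. by rewrite /rnorm normrN. Qed.

Lemma rnormB (V : normedZmodType R[i]) (x y : V) :
  rnorm (x - y) <= rnorm x + rnorm y.
Proof. by rewrite -(rnormN y) rnormD. Qed.

Lemma rdistC (V : normedZmodType R[i]) (x y : V) : rnorm (x - y) = rnorm (y - x).
Proof. by rewrite -rnormN opprB. Qed.

Lemma rnormZ (V : normedModType R[i]) (l : R[i]) (x : V) :
  rnorm (l *: x) = rnorm l * rnorm x.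
Proof. by apply: complexI; rewrite rmorphM /= -!rnormE normrZ. Qed.

Lemma rnormM (l m : R[i]) : rnorm (l * m) = rnorm l * rnorm m.
Proof. by apply: complexI; rewrite rmorphM /= -!rnormE normrM. Qed.

Lemma rnormX (l : R[i]) n : rnorm (l ^+ n) = rnorm l ^+ n.
Proof. by apply: complexI; rewrite rmorphXn /= -!rnormE normrX. Qed.

Lemma rnormV (l : R[i]) : rnorm l^-1 = (rnorm l)^-1.
Proof. by apply: complexI; rewrite fmorphV /= -!rnormE normfV. Qed.

Lemma rnorm_real (x : R) : rnorm x%:C = `|x|.
Proof. by apply: complexI; rewrite -rnormE normc_def /= expr0n addr0 sqrtr_sqr. Qed.

Lemma rnorm_1 : rnorm (1 : R[i]) = 1.
Proof. by rewrite (rnorm_real 1) normr1. Qed.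

Lemma rnorm_conj (l : R[i]) : rnorm l^* = rnorm l.
Proof. by rewrite /rnorm normcJ. Qed.

Lemma rnorm_sqr (l : R[i]) :
  rnorm l ^+ 2 = complex.Re l ^+ 2 + complex.Im l ^+ 2.
Proof. by apply: complexI; rewrite rmorphXn /= -rnormE add_Re2_Im2. Qed.

Lemma Re_le_rnorm (l : R[i]) : `|complex.Re l| <= rnorm l.
Proof. by rewrite -lecR -rnormE normc_ge_Re. Qed.

Lemma Im_le_rnorm (l : R[i]) : `|complex.Im l| <= rnorm l.
Proof.
rewrite -(@ler_pXn2r _ 2) ?nnegrE ?rnorm_ge0 // rnorm_sqr -normrX ger0_norm ?sqr_ge0 //.
by rewrite lerDr sqr_ge0.
Qed.

Lemma rnorm_le_ReIm (l : R[i]) : rnorm l <= `|complex.Re l| + `|complex.Im l|.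
Proof.
rewrite -(@ler_pXn2r _ 2) ?nnegrE ?rnorm_ge0 ?addr_ge0 // rnorm_sqr sqrrD.
rewrite !real_normK ?num_real //.
by have := mulr_ge0 (normr_ge0 (complex.Re l)) (normr_ge0 (complex.Im l)); lra.
Qed.

Lemma real_complex_Re (l : R[i]) : complex.Im l = 0 -> l = (complex.Re l)%:C.
Proof. by case: l => a b /= ->. Qed.

Lemma ler0_mul_eps (c x : R) : (forall e, 0 < e -> x <= c * e) -> x <= 0.
Proof.
move=> h; rewrite leNgt; apply/negP => x0.
have c1 : 0 < `|c| + 1 by rewrite ltr_pwDr.
have := h _ (divr_gt0 x0 c1); rewrite mulrA ler_pdivlMr // mulrC ler_pM2r //.
by have := ler_norm c; lra.
Qed.

Lemma expr_eventually_le (q e : R) : 0 <= q -> q < 1 -> 0 < e ->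
  exists n, forall m, (n <= m)%N -> q ^+ m <= e.
Proof.
move=> q0 q1 e0.
have q1' : `|q| < 1 by rewrite ger0_norm.
have /cvgrPdist_le /(_ e e0) [n _ h] := cvg_expr q1'.
exists n => m nm; have := h m nm.
by rewrite /= sub0r normrN ger0_norm // exprn_ge0.
Qed.

End RealNorm.

(** Unital C*-algebras with a real-valued norm and sequential completeness, as data over an algebra.
    The spectral theory is carried out for this record, which the unitization of [A]
    instantiates. *)
Record ucstar (R : realType) (B : algType R[i]) : Type := UCstar {
  unorm : B -> R;
  ustar : B -> B;
  unorm_ge0 : forall x, 0 <= unorm x;
  unorm_eq0 : forall x, unorm x = 0 -> x = 0;
  unormD : forall x y, unorm (x + y) <= unorm x + unorm y;
  unormZ : forall l x, unorm (l *: x) = rnorm l * unorm x;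
  unormM : forall x y, unorm (x * y) <= unorm x * unorm y;
  unorm_cstar : forall x, unorm (ustar x * x) = unorm x ^+ 2;
  ustarK : involutive ustar;
  ustarD : {morph ustar : x y / x + y};
  ustarZ : forall l x, ustar (l *: x) = l^* *: ustar x;
  ustarM : forall x y, ustar (x * y) = ustar y * ustar x;
  ucomplete : forall u : nat -> B,
    (forall e, 0 < e -> exists n, forall m, (n <= m)%N -> unorm (u m - u n) <= e) ->
    exists l, forall e, 0 < e -> exists n, forall m, (n <= m)%N -> unorm (u m - l) <= e
}.

(** * Two-sided inverses in an algebra *)

Section Invertible.
Context {K : comNzRingType} {B : algType K}.
Implicit Types x y : B.

Definition uinverse x y := x * y = 1 /\ y * x = 1.
Definition uinv x := exists y, uinverse x y.

Lemma uinverseM x y x' y' :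
  uinverse x x' -> uinverse y y' -> uinverse (x * y) (y' * x').
Proof.
move=> [x1 x2] [y1 y2]; split.
  by rewrite mulrA -(mulrA x) y1 mulr1.
by rewrite mulrA -(mulrA y') x2 mulr1.
Qed.

Lemma uinvM x y : uinv x -> uinv y -> uinv (x * y).
Proof. by move=> [x' hx] [y' hy]; exists (y' * x'); apply: uinverseM. Qed.

Lemma uinv1 : uinv 1. Proof. by exists 1; split; rewrite mulr1. Qed.

(** The left inverse [z * y] and the right inverse [y * z] of [x] coincide. Applied to the factor
    [l - b] of [p(l) - p(b)], this gives one inclusion of the spectral mapping theorem. *)
Lemma uinv_comm x y : x * y = y * x -> uinv (x * y) -> uinv x.
Proof.
move=> xy [z [h1 h2]].
have h3 : (z * y) * x = 1 by rewrite -mulrA -xy.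
have h4 : x * (y * z) = 1 by rewrite mulrA.
exists (y * z); split=> //.
by rewrite -[y * z]mul1r -h3 -(mulrA (z * y)) h4 mulr1.
Qed.

Lemma uinvZ (l m : K) x : l * m = 1 -> uinv x -> uinv (l *: x).
Proof.
move=> lm [y [xy yx]]; exists (m *: y).
split; rewrite -scalerAl -scalerAr scalerA.
  by rewrite lm xy scale1r.
by rewrite mulrC lm yx scale1r.
Qed.

Lemma uinvN x : uinv x -> uinv (- x).
Proof. by rewrite -scaleN1r; apply: (@uinvZ _ (-1)); rewrite mulrNN mulr1. Qed.

End Invertible.

(** * Neumann series, spectrum and bounds for resolvents *)

Section UCstarTheory.
Context {R : realType} {B : algType R[i]} (S : ucstar B).
Implicit Types (x y b : B) (l : R[i]) (p q : {poly R[i]}).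

Local Notation N := (unorm S).
Local Notation st := (ustar S).

Lemma unorm0 : N 0 = 0.
Proof. by rewrite -(scale0r 0) unormZ rnorm0 mul0r. Qed.

Lemma unormN x : N (- x) = N x.
Proof. by rewrite -scaleN1r unormZ rnormN rnorm_1 mul1r. Qed.

Lemma unormB x y : N (x - y) <= N x + N y.
Proof. by rewrite -(unormN y) unormD. Qed.

Lemma udistC x y : N (x - y) = N (y - x).
Proof. by rewrite -unormN opprB. Qed.

Lemma unorm_tri y x z : N (x - z) <= N (x - y) + N (y - z).
Proof. by rewrite -[x - z](subrKA y) unormD. Qed.

Lemma ustar0 : st 0 = 0.
Proof. by rewrite -(scale0r 0) ustarZ rmorph0 !scale0r. Qed.

Lemma ustarN x : st (- x) = - st x.
Proof. by rewrite -scaleN1r ustarZ rmorphN rmorph1 scaleN1r. Qed.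

Lemma ustarB x y : st (x - y) = st x - st y.
Proof. by rewrite ustarD ustarN. Qed.

Lemma ustar1 : st 1 = 1.
Proof. by rewrite -[st 1]mulr1 -{2}(ustarK S 1) -ustarM mulr1 ustarK. Qed.

Lemma unorm1 : N 1 = 1.
Proof.
have := unorm_cstar S 1; rewrite ustar1 mulr1 => h.
have : N 1 * (N 1 - 1) = 0 by rewrite mulrBr mulr1 -expr2 -h subrr.
move/eqP; rewrite mulf_eq0 => /orP[/eqP /unorm_eq0 /eqP|/eqP]; last lra.
by rewrite oner_eq0.
Qed.

Lemma unorm_alg l : N l%:A = rnorm l.
Proof. by rewrite unormZ unorm1 mulr1. Qed.

Lemma unorm_star x : N (st x) = N x.
Proof.
have h y : N y <= N (st y).
  have [->|y0] := eqVneq (N y) 0; first exact: unorm_ge0.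
  have y1 : 0 < N y by rewrite lt0r y0 unorm_ge0.
  by rewrite -(ler_pM2r y1) -expr2 -unorm_cstar unormM.
by apply: le_anti; rewrite h -{2}(ustarK S x) h.
Qed.

Lemma unorm_sa x : st x = x -> N (x * x) = N x ^+ 2.
Proof. by move=> {1}<-; rewrite unorm_cstar. Qed.

Lemma unorm_small (c : R) x : (forall e, 0 < e -> N x <= c * e) -> x = 0.
Proof.
move=> h; apply: (@unorm_eq0 _ _ S); apply: le_anti.
by rewrite unorm_ge0 (ler0_mul_eps h).
Qed.

Lemma unormX x n : N (x ^+ n) <= N x ^+ n.
Proof.
elim: n => [|n ih]; first by rewrite !expr0 unorm1.
by rewrite !exprS (le_trans (unormM _ _ _)) // ler_wpM2l // unorm_ge0.
Qed.

(** The recursion [u n.+1 = 1 + x * u n] bounds the partial sums of the geometric series by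
    [(1 - N x)^-1]; with [u (n + k) - u n = x ^+ n * u k] this makes them Cauchy. *)
Lemma neumann x : N x < 1 ->
  exists y, uinverse (1 - x) y /\ N y <= (1 - N x)^-1.
Proof.
move=> x1; have x0 := unorm_ge0 S x.
have d0 : 0 < 1 - N x by lra.
pose u n := \sum_(i < n) x ^+ i.
have uS n : u n.+1 = 1 + x * u n.
  rewrite /u big_ord_recl expr0 mulr_sumr; congr (_ + _).
  by apply: eq_bigr => i _; rewrite /= exprS.
have uSr n : u n.+1 = 1 + u n * x.
  rewrite /u big_ord_recl expr0 mulr_suml; congr (_ + _).
  by apply: eq_bigr => i _; rewrite /= exprSr.
have uB n : N (u n) <= (1 - N x)^-1.
  elim: n => [|n ih]; first by rewrite /u big_ord0 unorm0 invr_ge0 ltW.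
  rewrite uS (le_trans (unormD _ _ _)) // unorm1.
  apply: (@le_trans _ _ (1 + N x * (1 - N x)^-1)).
    by rewrite lerD2l (le_trans (unormM _ _ _)) // ler_wpM2l.
  by rewrite -[X in X + _](divff (lt0r_neq0 d0)) -mulrDl subrK mul1r.
have uD n k : u (n + k)%N - u n = x ^+ n * u k.
  rewrite /u big_split_ord /= mulr_sumr addrAC subrr add0r.
  by apply: eq_bigr => i _; rewrite exprD.
have uX n : (1 - x) * u n = 1 - x ^+ n.
  by rewrite -opprB mulNr /u -subrX1 opprB.
have uXr n : u n * (1 - x) = 1 - x ^+ n.
  rewrite -uX mulrBr mulrBl mulr1 mul1r; congr (_ - _).
  by apply: (@addrI _ 1); rewrite -uS -uSr.
have [y hy] : exists l : B, forall e, 0 < e ->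
    exists n, forall m, (n <= m)%N -> N (u m - l) <= e.
  apply: ucomplete => e e0.
  have [n hn] := expr_eventually_le x0 x1 (mulr_gt0 e0 d0).
  exists n => m nm; rewrite -(subnKC nm) uD (le_trans (unormM _ _ _)) //.
  rewrite -[e](mulfK (lt0r_neq0 d0)) ler_pM ?unorm_ge0 ?uB //.
  by rewrite (le_trans (unormX _ _)) // hn.
(* A single index makes both errors small, so the two inverse identities are checked there up to
   [2 * e + e], using [N (1 - x) <= 2], instead of passing to limits. *)
have yX e : 0 < e -> exists n, N (u n - y) <= e /\ N (x ^+ n) <= e.
  move=> e0; have [n1 h1] := hy _ e0.
  have [n2 h2] := expr_eventually_le x0 x1 e0.
  exists (n1 + n2)%N; split; first by rewrite h1 ?leq_addr.
  by rewrite (le_trans (unormX _ _)) // h2 ?leq_addl.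
have x2 : N (1 - x) <= 2.
  by rewrite (le_trans (unormB _ _)) // unorm1; lra.
exists y; split; [split|].
- apply/eqP; rewrite -subr_eq0; apply/eqP; apply: (@unorm_small 3) => e e0.
  have [n [h1 h2]] := yX e e0.
  have -> : (1 - x) * y - 1 = (1 - x) * (y - u n) - x ^+ n.
    by rewrite mulrBr uX opprB addrA addrAC addrK.
  rewrite (le_trans (unormB _ _)) //.
  have := unormM S (1 - x) (y - u n); rewrite udistC in h1.
  by have := unorm_ge0 S (y - u n); nra.
- apply/eqP; rewrite -subr_eq0; apply/eqP; apply: (@unorm_small 3) => e e0.
  have [n [h1 h2]] := yX e e0.
  have -> : y * (1 - x) - 1 = (y - u n) * (1 - x) - x ^+ n.
    by rewrite mulrBl uXr opprB addrA addrAC addrK.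
  rewrite (le_trans (unormB _ _)) //.
  have := unormM S (y - u n) (1 - x); rewrite udistC in h1.
  by have := unorm_ge0 S (y - u n); nra.
- rewrite -subr_le0; apply: (@ler0_mul_eps _ 1) => e e0; rewrite mul1r.
  have [n [h1 _]] := yX e e0; rewrite udistC in h1.
  have := unormD S (y - u n) (u n); rewrite subrK.
  by have := uB n; lra.
Qed.

Definition usp x : set R[i] := [set l | ~ uinv (l%:A - x)].

Lemma uspP x l : ~ usp x l -> uinv (l%:A - x).
Proof. by move=> /contrapT. Qed.

Lemma usp_norm x l : usp x l -> rnorm l <= N x.
Proof.
move=> h; rewrite leNgt; apply/negP => hl; apply: h.
have l0' : 0 < rnorm l by rewrite (le_lt_trans _ hl) ?unorm_ge0.
have l0 : l != 0 by apply: contraTneq l0' => ->; rewrite rnorm0 ltxx.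
have [|y [hy _]] := @neumann (l^-1 *: x).
  by rewrite unormZ rnormV mulrC ltr_pdivrMr // mul1r.
have -> : l%:A - x = l *: (1 - l^-1 *: x).
  by rewrite scalerBr scalerA divff // scale1r.
by apply: (@uinvZ _ _ _ l^-1); [rewrite divff|exists y].
Qed.

(** Everything follows from the resolvent identity [y' - x' = x' * (x - y) * y']. The smallness
    assumption gives [N y' <= N x' + N y' / 2], where the last term can be absorbed. *)
Lemma inverse_perturb x y x' y' : uinverse x x' -> uinverse y y' ->
  N (x - y) * N x' <= 2^-1 ->
  N y' <= 2 * N x' /\ N (y' - x') <= 2 * N (x - y) * N x' ^+ 2.
Proof.
move=> [_ hx] [hy _] h.
have e : y' - x' = x' * (x - y) * y'.
  by rewrite mulrBr hx mulrBl mul1r -mulrA hy mulr1.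
have d : N (y' - x') <= N x' * N (x - y) * N y'.
  rewrite e (le_trans (unormM _ _ _)) // ler_wpM2r ?unorm_ge0 //.
  exact: unormM.
have x0 := unorm_ge0 S x'; have y0 := unorm_ge0 S y'; have d0 := unorm_ge0 S (x - y).
have y2 : N y' <= 2 * N x'.
  have := unormD S (y' - x') x'; rewrite subrK => h'.
  by have := ler_wpM2r y0 h; lra.
split=> //; apply: (le_trans d); rewrite [leRHS](_ : _ = N x' * N (x - y) * (2 * N x')).
  by rewrite ler_wpM2l // mulr_ge0.
by ring.
Qed.

(** The half circle given by the sign [sg] is parametrized by its real part [s], so that compactness
    of a real segment suffices. In its near-covering form, compactness turns local bounds on the
    inverses into one bound. *)
Lemma resolvent_bounded_half b (sg : R) :
  (forall l, rnorm l = 1 -> uinv (1 - l *: b)) ->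
  `|sg| = 1 ->
  exists M : R, forall s, -1 <= s <= 1 ->
    forall y, uinverse (1 - (s +i* (sg * Num.sqrt (1 - s ^+ 2))) *: b) y -> N y <= M.
Proof.
move=> hb sg1.
pose mu (s : R) : R[i] := s +i* (sg * Num.sqrt (1 - s ^+ 2)).
have mu1 s : -1 <= s <= 1 -> rnorm (mu s) = 1.
  move=> hs; apply/eqP; rewrite -(@eqrXn2 _ 2) ?rnorm_ge0 // rnorm_sqr /= exprMn.
  rewrite -(real_normK (num_real sg)) sg1 expr1n mul1r sqr_sqrtr ?expr1n; last by nra.
  by rewrite addrC subrK.
have cs : continuous (fun s : R => Num.sqrt (1 - s ^+ 2)).
  move=> s; apply: (@continuous_comp _ _ _ (fun s : R => 1 - s ^+ 2) Num.sqrt).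
    by apply: cvgB; [exact: cvg_cst|exact: exprn_continuous].
  exact: sqrt_continuous.
have cmu s0 e : 0 < e -> \forall s \near (s0 : R), rnorm (mu s0 - mu s) <= e.
  move=> e0.
  have /cvgrPdist_le h1 : (fun s : R => s) @ s0 --> s0 by exact: cvg_id.
  have /cvgrPdist_le h2 := cs s0.
  near=> s; apply: (le_trans (rnorm_le_ReIm _)); rewrite /= -mulrBr normrM sg1 mul1r.
  rewrite (splitr e) lerD //.
    by near: s; apply: h1; rewrite divr_gt0.
  by near: s; apply: h2; rewrite divr_gt0.
have /compact_near_coveringP/(_ R +oo%R
  (fun M s => -1 <= s <= 1 -> forall y, uinverse (1 - mu s *: b) y -> N y <= M) _) h :=
  @segment_compact R (-1) 1.
have /filter_ex [M hM] : \forall M \near +oo%R, `[-1, 1]%classic `<=`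
    (fun s : R => -1 <= s <= 1 -> forall y, uinverse (1 - mu s *: b) y -> N y <= M).
  apply: h => s0; rewrite /= in_itv /= => hs0.
  have [y0 hy0] := hb _ (mu1 _ hs0).
  have b1 : 0 < 2 * (N b + 1) * (N y0 + 1).
    by rewrite !mulr_gt0 // ltr_pwDr ?unorm_ge0.
  (* The tolerance makes [N (x - y) * N x' <= 2^-1] in [inverse_perturb], which then bounds nearby
     inverses by [2 * N y0]; the added ones keep the denominator positive. *)
  have : \forall s \near s0 & M \near +oo%R,
     rnorm (mu s0 - mu s) <= (2 * (N b + 1) * (N y0 + 1))^-1 /\ 2 * N y0 <= M.
    near=> s M; rewrite /=; split.
      by near: s; apply: cmu; rewrite invr_gt0.
    by near: M; apply: nbhs_pinfty_ge; rewrite num_real.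
  apply: filterS => -[s M] /= [h1 h2] hs y hy.
  apply: le_trans h2.
  apply: (proj1 (inverse_perturb hy0 hy _)).
  rewrite opprB addrC addrA subrK -scalerBl unormZ rdistC.
  have d0 := rnorm_ge0 (mu s0 - mu s); have bb0 := unorm_ge0 S b; have yy0 := unorm_ge0 S y0.
  rewrite -(ler_pM2r b1) mulVf ?lt0r_neq0 // in h1.
  apply: (@le_trans _ _ (rnorm (mu s0 - mu s) * ((N b + 1) * (N y0 + 1)))); last lra.
  rewrite -mulrA ler_wpM2l // ler_pM // lerDl //.
exists M => s hs; apply: hM => //; by rewrite /= in_itv.
Unshelve. all: by end_near.
Qed.

Lemma resolvent_bounded b : (forall l, rnorm l = 1 -> uinv (1 - l *: b)) ->
  exists2 M : R, 0 < M & forall l, rnorm l = 1 ->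
    forall y, uinverse (1 - l *: b) y -> N y <= M.
Proof.
move=> hb.
have [M1 h1] := resolvent_bounded_half hb (normr1 R).
have [M2 h2] := resolvent_bounded_half hb (normrN1 R).
exists (`|M1| + `|M2| + 1); first by rewrite ltr_pwDr // addr_ge0.
have n1 := ler_norm M1; have n2 := ler_norm M2.
have p1 := normr_ge0 M1; have p2 := normr_ge0 M2.
move=> [s t] l1; have := rnorm_sqr (s +i* t); rewrite l1 expr1n /= => e1.
have hs : -1 <= s <= 1.
  rewrite -ler_norml -(@ler_pXn2r _ 2) ?nnegrE //.
  by rewrite real_normK ?num_real // expr1n; nra.
have et : 1 - s ^+ 2 = t ^+ 2 by lra.
have := h1 s hs; have := h2 s hs; rewrite et sqrtr_sqr mul1r mulN1r => k2 k1 y hy.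
have [t0|t0] := leP 0 t.
  by rewrite (ger0_norm t0) in k1; have := k1 _ hy; lra.
by rewrite (ltr0_norm t0) opprK in k2; have := k2 _ hy; lra.
Qed.

(* Rickart: with R_b(l) = (1 - l b)^-1 one has
   R_{b^2}(l^2) = (R_b(l) + R_b(-l)) / 2, so a bound for R_b(l) - R_b(r l) that
   is uniform on the circle is inherited by all powers b^(2^k); for r < 1 the
   second resolvent tends to 1, hence so does the first and b^(2^k) is small. *)
Lemma resolvent_circle_absurd b : (forall k, N (b ^+ (2 ^ k)) = 1) ->
  (forall l, rnorm l = 1 -> uinv (1 - l *: b)) -> False.
Proof.
move=> hN hb; have [M M0 hM] := resolvent_bounded hb.
have b1 : N b = 1 by have := hN 0%N; rewrite expn0 expr1.
(* This [d] is small enough for [d * M <= 2^-1], the hypothesis of [inverse_perturb], and for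
   [2 * d * M ^+ 2 <= 8^-1], the resolvent bound at [k = 0]. *)
pose d : R := (16 * M ^+ 2 + 2 * M + 2)^-1.
have D0 : 0 < 16 * M ^+ 2 + 2 * M + 2 by nra.
have d0 : 0 < d by rewrite invr_gt0.
have dD : d * (16 * M ^+ 2 + 2 * M + 2) = 1 by rewrite mulVf // lt0r_neq0.
have dM : d * M <= 2^-1 by nra.
have dM2 : 2 * d * M ^+ 2 <= 8^-1 by nra.
have d1 : d <= 2^-1 by nra.
pose r : R := 1 - d.
have r0 : 0 <= r by rewrite /r; lra.
have r1 : r < 1 by rewrite /r; lra.
have rnr k : rnorm (r ^+ k)%:C = r ^+ k by rewrite rnorm_real ger0_norm ?exprn_ge0.
have step k l : rnorm l = 1 -> exists x y,
    [/\ uinverse (1 - l *: b ^+ (2 ^ k)) x,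
        uinverse (1 - ((r ^+ (2 ^ k))%:C * l) *: b ^+ (2 ^ k)) y &
        N (x - y) <= 8^-1].
  elim: k l => [|k ih] l l1.
    rewrite expn0 !expr1; have [x hx] := hb l l1.
    have [y [hy _]] : exists y, uinverse (1 - (r%:C * l) *: b) y /\
        N y <= (1 - N ((r%:C * l) *: b))^-1.
      apply: neumann; rewrite unormZ b1 mulr1 rnormM l1 mulr1.
      by have := rnr 1%N; rewrite !expr1 => ->.
    exists x, y; split=> //.
    have xM := hM _ l1 _ hx; have x0 := unorm_ge0 S x.
    have e : N (1 - l *: b - (1 - (r%:C * l) *: b)) = d.
      rewrite opprB addrC addrA subrK -scalerBl unormZ b1 mulr1.
      rewrite -[X in _ - X]mul1r -mulrBl rnormM l1 mulr1.
      rewrite -(rmorph1 (real_complex R)) -rmorphB /= rnorm_real distrC.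
      by rewrite /r opprB addrC subrK ger0_norm ?ltW.
    have := inverse_perturb hx hy; rewrite e => /(_ _)[|_ h].
      by apply: le_trans dM; rewrite ler_wpM2l // ltW.
    rewrite udistC; apply: (le_trans h); apply: le_trans dM2.
    apply: ler_wpM2l; first by rewrite mulr_ge0 // ltW.
    by rewrite ler_pXn2r // nnegrE ltW.
  pose m := sqrtc l; have m2 : m ^+ 2 = l by exact: sqr_sqrtc.
  have m1 : rnorm m = 1.
    by apply/eqP; rewrite -(@eqrXn2 _ 2) ?rnorm_ge0 // -rnormX m2 l1 expr1n.
  have m1' : rnorm (- m) = 1 by rewrite rnormN.
  have [x [y [hx hy hxy]]] := ih _ m1.
  have [x' [y' [hx' hy' hxy']]] := ih _ m1'.
  have halve (c : R[i]) (z z' w : B) : uinverse (1 - c *: w) z ->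
      uinverse (1 - (- c) *: w) z' ->
      uinverse (1 - (c ^+ 2) *: w ^+ 2) (2^-1 *: (z + z')).
    move=> hz hz'.
    have e1 : 1 - (c ^+ 2) *: w ^+ 2 = (1 - c *: w) * (1 - (- c) *: w).
      rewrite scaleNr opprK mulrDr mulr1 mulrBl mul1r addrA subrK.
      by rewrite -scalerAl -scalerAr scalerA -!expr2.
    have e2 : 1 - (c ^+ 2) *: w ^+ 2 = (1 - (- c) *: w) * (1 - c *: w).
      rewrite scaleNr opprK mulrBr mulr1 mulrDl mul1r opprD addrA addrK.
      by rewrite -scalerAl -scalerAr scalerA -!expr2.
    have [hz1 hz2] := hz; have [hz1' hz2'] := hz'.
    have t2 : (1 - (- c) *: w) + (1 - c *: w) = 2 *: 1.
      by rewrite scaleNr opprK addrACA subrr addr0 scaler_nat mulr2n.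
    have t2' : (1 - c *: w) + (1 - (- c) *: w) = 2 *: 1 by rewrite addrC.
    split.
      rewrite -scalerAr mulrDr {1}e2 e1 -!mulrA hz1 hz1' !mulr1 t2 scalerA.
      by rewrite mulVf ?scale1r // pnatr_eq0.
    rewrite -scalerAl mulrDl {1}e1 e2 !mulrA hz2 hz2' !mul1r t2 scalerA.
    by rewrite mulVf ?scale1r // pnatr_eq0.
  exists (2^-1 *: (x + x')), (2^-1 *: (y + y')).
  rewrite expnS mulnC exprM -m2; split.
  - exact: halve.
  - rewrite exprM rmorphXn /= -exprMn; apply: halve => //.
    by rewrite -mulrN.
  - rewrite -scalerBr opprD addrACA unormZ.
    have -> : rnorm (2^-1 : R[i]) = 2^-1.
      by rewrite rnormV -(rmorph_nat (real_complex R)) rnorm_real normr_nat.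
    by have := unormD S (x - y) (x' - y'); lra.
have [k hk] : exists k, r ^+ (2 ^ k) <= 8^-1.
  have [k hk] := expr_eventually_le r0 r1 (ltac:(lra) : 0 < 8^-1 :> R).
  by exists k; apply: hk; rewrite ltnW // ltn_expl.
have [x [y [[_ hx] [_ hy] hxy]]] := step k _ rnorm_1.
set c := b ^+ (2 ^ k) in hx hy.
have c1 : N c = 1 by exact: hN.
(* From [y - 1 = r ^+ (2 ^ k) * y * c] one gets [N (y - 1) <= (N (y - 1) + 1) / 8]. *)
have y1 : N (y - 1) <= 7^-1.
  have e : y - 1 = y * (((r ^+ (2 ^ k))%:C * 1) *: c).
    by rewrite -[X in y - X]hy mulrBr !mulr1 opprB addrC subrK.
  have := unormM S y (((r ^+ (2 ^ k))%:C * 1) *: c).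
  rewrite -e unormZ mulr1 rnr c1 mulr1.
  have := unormD S (y - 1) 1; rewrite subrK unorm1.
  have := unorm_ge0 S y; have := unorm_ge0 S (y - 1).
  by have := exprn_ge0 (2 ^ k) r0; nra.
have x1 : N (x - 1) < 2^-1.
  by have := unorm_tri y x 1; lra.
(* Since [N c = 1], this identity yields [1 <= 2 * N (x - 1)], whereas [8^-1 + 7^-1 < 2^-1]. *)
have e : c = (x - 1) - (x - 1) * c.
  rewrite scale1r mulrBr mulr1 in hx.
  rewrite mulrBl mul1r; have -> : x * c = x - 1 by rewrite -hx opprB addrC subrK.
  by rewrite opprB addrC subrK.
have := unormB (x - 1) ((x - 1) * c); rewrite -e c1.
by have := unormM S (x - 1) c; rewrite c1; lra.
Qed.

End UCstarTheory.

(** * Spectra of self-adjoint elements *)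

Section SelfAdjoint.
Context {R : realType} {B : algType R[i]} (S : ucstar B).
Implicit Types (x y b : B) (l : R[i]) (p q : {poly R[i]}).

Local Notation N := (unorm S).
Local Notation st := (ustar S).
Local Notation sp := (@usp R B).

Lemma ustar_alg l : st l%:A = (l^*)%:A.
Proof. by rewrite ustarZ ustar1. Qed.

Lemma ustar_saM x : st (st x * x) = st x * x.
Proof. by rewrite ustarM ustarK. Qed.

(** Self-adjointness enters through the C*-identity: after scaling to norm one, all the powers
    [c ^+ (2 ^ k)] keep norm one. Were there no spectral point of modulus at least [N b], then
    [1 - l *: c] would be invertible on the whole unit circle. *)
Lemma usp_radius b : st b = b -> exists2 l, sp b l & N b <= rnorm l.
Proof.
move=> sb; have [b0|b0] := eqVneq (N b) 0.
  exists 0; last by rewrite b0 rnorm_ge0.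
  rewrite (unorm_eq0 b0) => -[y [/eqP]].
  by rewrite scale0r subr0 mul0r eq_sym oner_eq0.
have bp : 0 < N b by rewrite lt0r b0 unorm_ge0.
have bc0 : (N b)%:C != 0 :> R[i] by apply: contra b0 => /eqP [->].
have rb : rnorm (N b)%:C = N b by rewrite rnorm_real ger0_norm // ltW.
apply: contrapT => hn.
pose c := (N b)%:C^-1 *: b.
have Nc : N c = 1 by rewrite unormZ rnormV rb mulVf.
have sc : st c = c.
  by rewrite ustarZ sb fmorphV; congr (_^-1 *: _); apply: conjc_real.
have sX n : st (c ^+ n) = c ^+ n.
  by elim: n => [|n ih]; rewrite ?expr0 ?ustar1 // exprS ustarM ih sc -exprSr exprS.
apply: (@resolvent_circle_absurd _ _ S c) => [k|l l1].
  elim: k => [|k ih]; first by rewrite expn0 expr1.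
  by rewrite expnS mulnC exprM expr2 unorm_sa // ih expr1n.
have l0 : l != 0.
  by apply/negP => /eqP l0; move: l1; rewrite l0 rnorm0 => /eqP; rewrite eq_sym oner_eq0.
pose m := (N b)%:C * l^-1.
have m0 : m != 0 by rewrite mulf_neq0 // invr_eq0.
have -> : 1 - l *: c = m^-1 *: (m%:A - b).
  rewrite scalerBr [m^-1 *: (m *: 1)]scalerA mulVf // scale1r /c scalerA /m.
  by rewrite invfM invrK mulrC.
apply: (@uinvZ _ _ _ m); first by rewrite mulVf.
apply: (@uspP _ _ b) => hm; apply: hn; exists m => //.
by rewrite rnormM rnormV l1 invr1 mulr1 rb.
Qed.

(** Arens's trick: shifting [b] by [i s] shifts the spectrum by [i s], but raises the squared norm
    by at most [s ^+ 2]. A nonzero imaginary part would contribute a term linear in [s]. *)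
Lemma usp_real b l : st b = b -> sp b l -> l = (complex.Re l)%:C.
Proof.
move=> sb hl; apply: real_complex_Re.
have key (s : R) : rnorm (l + s *i) ^+ 2 <= N b ^+ 2 + s ^+ 2.
  have : sp (b + (s *i)%:A) (l + s *i).
    by rewrite /usp /= scalerDl opprD addrACA subrr addr0.
  move/(usp_norm S) => h.
  apply: (@le_trans _ _ (N (b + (s *i)%:A) ^+ 2)).
    by rewrite ler_pXn2r ?nnegrE ?rnorm_ge0 ?unorm_ge0.
  rewrite -unorm_cstar ustarD sb ustar_alg.
  have -> : (s *i)^* = - (s *i) :> R[i].
    by apply/eqP; rewrite eq_complex /= oppr0 !eqxx.
  rewrite scaleNr mulrDr !mulrBl -!scalerAl -!scalerAr !mul1r !mulr1.
  rewrite addrA subrK scalerA (le_trans (unormB _ _ _)) // unorm_alg rnormM.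
  have -> : rnorm (s *i) * rnorm (s *i) = s ^+ 2.
    by rewrite -expr2 rnorm_sqr /= expr0n add0r.
  by rewrite lerD2r unorm_sa.
apply/eqP/negPn/negP => h0.
(* With this [s] the cross term [2 * Im l * s] is [N b ^+ 2 + 1], more than [key] leaves room
   for. *)
have := key ((N b ^+ 2 + 1) / (2 * complex.Im l)).
set s := _ / _; rewrite rnorm_sqr raddfD /= raddfD /= addr0.
have hs : 2 * complex.Im l * s = N b ^+ 2 + 1.
  by rewrite /s mulrC divfK // mulf_neq0 // pnatr_eq0.
by have := sqr_ge0 (complex.Re l); have := sqr_ge0 (complex.Im l); nra.
Qed.

Lemma horner_alg_star b p : st b = b ->
  st (horner_alg b p) = horner_alg b (map_poly Num.conj p).
Proof.
move=> sb; elim/poly_ind: p => [|p c ih].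
  by rewrite map_poly0 !rmorph0 ustar0.
rewrite !rmorphD !rmorphM /= map_polyX map_polyC /= !horner_algX !horner_algC.
rewrite ustarD ustarM sb ih ustar_alg; congr (_ + _).
set q := map_poly _ p.
have : horner_alg b ('X * q) = horner_alg b (q * 'X) by rewrite mulrC.
by rewrite !rmorphM /= horner_algX.
Qed.

Lemma usp_horner_alg b p l : sp b l -> sp (horner_alg b p) p.[l].
Proof.
move=> hl hu; apply: hl.
have /factor_theorem [q hq] : root (p - p.[l]%:P) l.
  by rewrite rootE !hornerE subrr.
have e : p.[l]%:A - horner_alg b p = (l%:A - b) * horner_alg b q.
  have -> : l%:A - b = - horner_alg b ('X - l%:P).
    by rewrite rmorphB /= horner_algX horner_algC opprB.
  by rewrite mulNr -rmorphM mulrC -hq rmorphB /= horner_algC opprB.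
apply: (uinv_comm (y := horner_alg b q)); last by rewrite -e.
have -> : l%:A - b = - horner_alg b ('X - l%:P).
  by rewrite rmorphB /= horner_algX horner_algC opprB.
by rewrite mulNr mulrN -!rmorphM mulrC.
Qed.

(** Over an algebraically closed field [l - p] splits; if none of its roots is in the spectrum of
    [b], every linear factor is invertible at [b]. When [l - p] is zero any spectral point serves,
    and [usp_radius] provides one. *)
Lemma usp_horner_algP b p l : st b = b -> sp (horner_alg b p) l ->
  exists2 m, sp b m & l = p.[m].
Proof.
move=> sb hl; have [m0 hm0 _] := usp_radius sb.
pose q := l%:P - p.
have qE : horner_alg b q = l%:A - horner_alg b p.
  by rewrite rmorphB /= horner_algC.
have [q0|q0] := eqVneq q 0.
  by exists m0 => //; move/eqP: q0; rewrite subr_eq0 => /eqP <-; rewrite hornerC.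
apply: contrapT => hn; apply: hl; rewrite -qE.
have [r hr] := closed_field_poly_normal q.
have hsp m : m \in r -> ~ sp b m.
  move=> mr hm; apply: hn; exists m => //.
  have : root q m by rewrite hr rootZ ?lead_coef_eq0 // root_prod_XsubC.
  by rewrite rootE !hornerE subr_eq0 => /eqP.
have -> : horner_alg b q =
    lead_coef q *: horner_alg b (\prod_(z <- r) ('X - z%:P)).
  by rewrite {1}hr -mul_polyC rmorphM /= horner_algC mulr_algl.
apply: (@uinvZ _ _ _ (lead_coef q)^-1); first by rewrite divff // lead_coef_eq0.
elim: r hsp {hr} => [|m r ih] hsp; first by rewrite big_nil rmorph1; exact: uinv1.
rewrite big_cons rmorphM /=; apply: uinvM; last first.
  by apply: ih => m' hm'; apply: hsp; rewrite in_cons hm' orbT.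
rewrite rmorphB /= horner_algX horner_algC -opprB; apply: uinvN.
by apply: uspP; apply: hsp; rewrite mem_head.
Qed.

Lemma rnorm_horner_le b p l : sp b l -> rnorm p.[l] <= N (horner_alg b p).
Proof. by move=> /usp_horner_alg/usp_norm; apply. Qed.

(** For complex coefficients [p(b)] is merely normal, so [usp_radius] is applied to its product with
    its adjoint, again a polynomial in [b]; on the real spectrum this polynomial takes the value of
    modulus [rnorm p.[m] ^+ 2]. *)
Lemma unorm_horner_alg b p (c : R) : st b = b ->
  (forall l, sp b l -> rnorm p.[l] <= c) -> N (horner_alg b p) <= c.
Proof.
move=> sb h.
have c0 : 0 <= c.
  have [l hl _] := usp_radius sb; exact: le_trans (rnorm_ge0 _) (h l hl).
rewrite -(@ler_pXn2r _ 2) ?nnegrE ?unorm_ge0 //.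
rewrite -unorm_cstar.
have [l] := usp_radius (ustar_saM (horner_alg b p)).
rewrite {1}horner_alg_star // -rmorphM => /(usp_horner_algP sb) [m hm ->] hN.
apply: (le_trans hN); rewrite hornerM rnormM expr2.
have hm' := h m hm.
have -> : (map_poly Num.conj p).[m] = (p.[m])^*.
  have {1}<- : m^* = m by rewrite (usp_real sb hm); exact: conjc_real.
  by rewrite horner_map.
by rewrite rnorm_conj ler_pM ?rnorm_ge0.
Qed.

End SelfAdjoint.

(** * Polynomial approximation on a compact set of reals *)

Section Bernstein.
Context {R : realType}.
Implicit Types (t : R) (T : {poly R[i]}) (g : nat -> R[i]) (h : nat -> R).

(* The Bernstein operator, by the recursion corresponding to one more Bernoulli
   trial. *)
Fixpoint bern T n g : {poly R[i]} :=
  if n is n'.+1 then T * bern T n' (fun k => g k.+1) + (1 - T) * bern T n' g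
  else (g 0)%:P.

(** The expectation of [h] at a binomial variable with [n] trials of probability [t]. *)
Fixpoint rbern t n h : R :=
  if n is n'.+1 then t * rbern t n' (fun k => h k.+1) + (1 - t) * rbern t n' h
  else h 0.

Lemma bern_dist T n g t (x z : R[i]) h : 0 <= t <= 1 -> T.[x] = t%:C ->
  (forall k, rnorm (g k - z) <= h k) ->
  rnorm ((bern T n g).[x] - z) <= rbern t n h.
Proof.
move=> /andP[t0 t1] Tx; elim: n g h => [|n ih] g h hg /=.
  by rewrite hornerC.
rewrite !hornerE Tx.
set u := (bern _ _ _).[x]; set v := (bern _ _ _).[x].
have -> : t%:C * u + (1 - t%:C) * v - z = t%:C * (u - z) + (1 - t%:C) * (v - z) by ring.
rewrite (le_trans (rnormD _ _)) // !rnormM.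
rewrite -(rmorph1 (real_complex R)) -rmorphB /= !rnorm_real !ger0_norm ?subr_ge0 //.
by rewrite lerD // ler_wpM2l ?subr_ge0 //; [apply: ih => k; exact: hg|exact: ih].
Qed.

(** The mean and the variance of the binomial distribution. The offset [c] has to be general because
    a success shifts it by [b]. *)
Lemma rbern_sqr t n (a b c d : R) :
  rbern t n (fun k => a + d * (b * k%:R + c) ^+ 2) =
  a + d * ((b * (n%:R * t) + c) ^+ 2 + n%:R * b ^+ 2 * t * (1 - t)).
Proof.
elim: n c => [|n ih] c /=; first by ring.
have -> : (fun k => a + d * (b * k.+1%:R + c) ^+ 2) =
          (fun k => a + d * (b * k%:R + (b + c)) ^+ 2).
  by apply/funext => k; rewrite -natr1; ring.
by rewrite !ih -natr1; ring.
Qed.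

End Bernstein.

Section Weierstrass.
Context {R : realType} (K : set R) (f : R -> R[i]).
Hypothesis K_compact : compact K.
Hypothesis f_cont : forall x e, K x -> 0 < e ->
  exists2 d, 0 < d & forall y, K y -> `|x - y| <= d -> rnorm (f x - f y) <= e.

(** An error affine in the squared distance is what the binomial variance controls. Near the
    diagonal of [K * K] continuity alone gives [e]; elsewhere the squared distance is bounded below
    locally, and a large [C] compensates. Compactness of the product makes [C] uniform. *)
Lemma quadratic_modulus e : 0 < e -> exists2 C : R, 0 < C &
  forall x y, K x -> K y -> rnorm (f x - f y) <= e + C * (x - y) ^+ 2.
Proof.
move=> e0.
have /compact_near_coveringP/(_ R +oo%R (fun C (z : R * R) => K z.1 -> K z.2 ->
    rnorm (f z.1 - f z.2) <= e + C * (z.1 - z.2) ^+ 2) _) h :=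
  compact_setX K_compact K_compact.
have /filter_ex [C [C0 hC]] : \forall C \near +oo%R, 0 < C /\ (K `*` K `<=`
    (fun z : R * R => K z.1 -> K z.2 ->
    rnorm (f z.1 - f z.2) <= e + C * (z.1 - z.2) ^+ 2)).
  apply: filterI; first by apply: nbhs_pinfty_gt; exact: num_real.
  apply: h => -[x y] [/= Kx Ky].
  have near1 s0 : 0 < s0 -> \forall z \near (x, y), `|x - z.1| <= s0.
    have /cvgrPdist_le k : (fun z : R * R => z.1) @ (x, y) --> x by exact: cvg_fst.
    exact: k.
  have near2 s0 : 0 < s0 -> \forall z \near (x, y), `|y - z.2| <= s0.
    have /cvgrPdist_le k : (fun z : R * R => z.2) @ (x, y) --> y by exact: cvg_snd.
    exact: k.
  have [exy|nxy] := eqVneq x y.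
    have e2 : 0 < e / 2 by rewrite divr_gt0.
    have [d d0 hd] := f_cont Kx e2.
    have : \forall z \near (x, y) & C \near pinfty_nbhs R,
        [/\ `|x - z.1| <= d, `|y - z.2| <= d & 0 <= C].
      exists ([set z : R * R | `|x - z.1| <= d] `&` [set z | `|y - z.2| <= d],
              [set C : R | 0 <= C]); last by move=> [z C] /= [[]].
      split; first by apply: filterI; [exact: near1|exact: near2].
      by apply: nbhs_pinfty_ge; exact: num_real.
    apply: filterS => -[z C] /= [h1 h2 C0] K1 K2; rewrite -exy in h2.
    have := rnormB (f z.1 - f x) (f z.2 - f x); rewrite opprB addrA subrK.
    have := hd _ K1 h1; have := hd _ K2 h2.
    rewrite rdistC (rdistC (f x)) => k1 k2 k3.
    by have := mulr_ge0 C0 (sqr_ge0 (z.1 - z.2)); lra.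
  have [d1 d10 hd1] := f_cont Kx ltr01.
  have [d2 d20 hd2] := f_cont Ky ltr01.
  (* Moving both points by at most [D] leaves them at distance at least [2 * D]; [F] bounds the
     difference of the values of [f] at the moved points. *)
  pose D := `|x - y| / 4.
  have D0 : 0 < D by rewrite divr_gt0 // normr_gt0 subr_eq0.
  pose F := rnorm (f x) + rnorm (f y) + 2.
  have F0 : 0 <= F by have := rnorm_ge0 (f x); have := rnorm_ge0 (f y); rewrite /F; lra.
  have : \forall z \near (x, y) & C \near pinfty_nbhs R,
      [/\ `|x - z.1| <= d1, `|x - z.1| <= D, `|y - z.2| <= d2, `|y - z.2| <= D
        & F / (4 * D ^+ 2) <= C].
    exists (([set z : R * R | `|x - z.1| <= d1] `&` [set z | `|x - z.1| <= D]) `&`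
            ([set z | `|y - z.2| <= d2] `&` [set z | `|y - z.2| <= D]),
            [set C : R | F / (4 * D ^+ 2) <= C]); last by move=> [z C] /= [[[? ?] [? ?]] ?].
    split; last by apply: nbhs_pinfty_ge; exact: num_real.
    by do 2?apply: filterI; [exact: near1|exact: near1|exact: near2|exact: near2].
  apply: filterS => -[z C] /= [h1 h1' h2 h2' hC] K1 K2.
  have k1 := hd1 _ K1 h1; have k2 := hd2 _ K2 h2.
  have hz : 2 * D <= `|z.1 - z.2|.
    have : `|x - y| = 4 * D by rewrite /D; field.
    have : x - y = (x - z.1) + (z.1 - z.2) - (y - z.2) by ring.
    move=> {1}-> h4; have := ler_normB ((x - z.1) + (z.1 - z.2)) (y - z.2).
    by have := ler_normD (x - z.1) (z.1 - z.2); lra.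
  have hq : F <= C * (z.1 - z.2) ^+ 2.
    have D2 : 0 < 4 * D ^+ 2 by rewrite mulr_gt0 // exprn_gt0.
    have C0 : 0 <= C by apply: le_trans hC; rewrite divr_ge0 // ltW.
    rewrite ler_pdivrMr // in hC; apply: (le_trans hC); rewrite ler_wpM2l //.
    by rewrite -[leRHS]real_normK ?num_real //; nra.
  apply: (@le_trans _ _ F); last by lra.
  have := rnormB (f z.1) (f z.2).
  have := rnormB (f x) (f x - f z.1); rewrite opprB addrC subrK.
  have := rnormB (f y) (f y - f z.2); rewrite opprB addrC subrK.
  by rewrite /F; lra.
by exists C => // x y Kx Ky; apply: (hC (x, y)).
Qed.

Lemma almost_nearest (x e : R) : K !=set0 -> 0 < e ->
  exists y, K y /\ forall z, K z -> `|y - x| <= `|z - x| + e.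
Proof.
move=> [z0 Kz0] e0; pose E := [set `|z - x| | z in K].
have Einf : has_inf E.
  split; first by exists `|z0 - x|, z0.
  by exists 0 => _ [z _ <-].
have [_ [y Ky <-] hy] := inf_adherent e0 Einf.
exists y; split=> // z Kz; rewrite (le_trans (ltW hy)) // lerD2r.
by apply: ge_inf; [exact: Einf.2|exists z].
Qed.

(* Bernstein polynomials whose nodes, which need not lie in [K], are replaced
   by almost nearest points of [K]. *)
Lemma weierstrass (M e : R) : K !=set0 -> 0 < M -> (forall x, K x -> `|x| <= M) ->
  0 < e -> exists p : {poly R[i]}, forall x, K x -> rnorm (p.[x%:C] - f x) <= e.
Proof.
move=> K0 M0 KM e0.
have [C C0 hC] := quadratic_modulus (divr_gt0 e0 (ltr0n _ 2)).
(* The error budget is [e / 2] from [quadratic_modulus], [e / 4] from the displaced nodes, where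
   [2 * C * d ^+ 2 <= e / 4], and [e / 4] from the variance, which fixes [n]. *)
pose d := Num.min 1 (e / (8 * C)).
have d0 : 0 < d by rewrite lt_min ltr01 divr_gt0 // mulr_gt0.
have d1 : d <= 1 by rewrite ge_min lexx.
have dC : d * (8 * C) <= e by rewrite -ler_pdivlMr ?mulr_gt0 // ge_min lexx orbT.
have [n hn] : exists n : nat, 32 * C * M ^+ 2 / e <= n.+1%:R.
  exists (Num.truncn (32 * C * M ^+ 2 / e)); apply: ltW.
  exact: truncnS_gt.
have n0 : 0 < n.+1%:R :> R by rewrite ltr0n.
rewrite ler_pdivrMr // in hn.
pose b : R := 2 * M / n.+1%:R; pose xi k : R := b * k%:R - M.
have [y hy] := choice (fun k => almost_nearest (xi k) K0 d0).
pose T : {poly R[i]} := ((2 * M)^-1)%:C *: ('X + M%:C%:P).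
exists (bern T n.+1 (f \o y)) => x Kx.
pose t := (x + M) / (2 * M).
have M2 : 0 < 2 * M by rewrite mulr_gt0.
have tM : t * (2 * M) = x + M by rewrite /t divfK // lt0r_neq0.
have /andP[xM1 xM2] : - M <= x <= M by rewrite -ler_norml KM.
have t0 : 0 <= t by apply: divr_ge0; [lra|exact: ltW].
have t1 : t <= 1 by rewrite ler_pdivrMr //; lra.
(* As [x] itself competes for being nearest to [xi k], one has [|y k - x| <= 2 |xi k - x| + d],
   whose square is at most [8 (xi k - x)^2 + 2 d^2]. *)
pose h k := e / 2 + 2 * C * d ^+ 2 + 8 * C * (b * k%:R + (- M - x)) ^+ 2.
apply: (@le_trans _ _ (rbern t n.+1 h)).
  apply: bern_dist; first by rewrite t0 t1.
    by rewrite !hornerE /= -rmorphD -rmorphM /= mulrC.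
  move=> k; have [Kyk hk] := hy k.
  have h1 := hC _ _ Kyk Kx; have h2 := hk _ Kx.
  apply: (le_trans h1); rewrite /h -addrA lerD2l.
  have h3 : (y k - x) ^+ 2 <= 2 * d ^+ 2 + 8 * (xi k - x) ^+ 2.
    have h4 : `|y k - x| <= 2 * `|xi k - x| + d.
      have := ler_normD (y k - xi k) (xi k - x); rewrite subrKA.
      by rewrite (distrC x) in h2; lra.
    have n1 := normr_ge0 (y k - x); have n2 := normr_ge0 (xi k - x).
    rewrite -[(y k - x) ^+ 2]real_normK ?num_real // -[(xi k - x) ^+ 2]real_normK ?num_real //.
    apply: (@le_trans _ _ ((2 * `|xi k - x| + d) ^+ 2)).
      by rewrite ler_pXn2r ?nnegrE //; lra.
    by have := sqr_ge0 (2 * `|xi k - x| - d); lra.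
  have -> : b * k%:R + (- M - x) = xi k - x by rewrite /xi; ring.
  by have := ler_wpM2l (ltW C0) h3; lra.
rewrite /h rbern_sqr.
(* The nodes [xi k] have mean [x], so only the variance term survives. *)
have -> : b * (n.+1%:R * t) + (- M - x) = 0.
  have -> : b * (n.+1%:R * t) = t * (2 * M) by rewrite /b; field; rewrite lt0r_neq0.
  by rewrite tM; ring.
rewrite expr0n /= add0r.
have -> : n.+1%:R * b ^+ 2 * t * (1 - t) = (4 * M ^+ 2 / n.+1%:R) * (t * (1 - t)).
  by rewrite /b; field; rewrite lt0r_neq0.
have tt : t * (1 - t) <= 4^-1 by have := sqr_ge0 (t - 2^-1); lra.
have q0 : 0 <= 4 * M ^+ 2 / n.+1%:R by rewrite divr_ge0 ?mulr_ge0 ?sqr_ge0 // ltW.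
have k1 : 8 * C * (4 * M ^+ 2 / n.+1%:R * (t * (1 - t))) <= e / 4.
  apply: (@le_trans _ _ (8 * C * (4 * M ^+ 2 / n.+1%:R * 4^-1))).
    by rewrite !ler_wpM2l // ltW // mulr_gt0.
  have -> : 8 * C * (4 * M ^+ 2 / n.+1%:R * 4^-1) = (8 * C * M ^+ 2) / n.+1%:R.
    by field; rewrite lt0r_neq0.
  by rewrite ler_pdivrMr //; lra.
have k2 : 2 * C * d ^+ 2 <= e / 4.
  by have := ler_wpM2l (ltW d0) d1; nra.
by apply: (@le_trans _ _ (e / 2 + e / 4 + e / 4)); [rewrite !lerD|lra].
Qed.

End Weierstrass.

(** * Continuous functional calculus *)

Section FunctionalCalculus.
Context {R : realType} {B : algType R[i]} (S : ucstar B).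
Implicit Types (x y z b : B) (l : R[i]) (p q : {poly R[i]}) (f g : R[i] -> R[i]).

Local Notation N := (unorm S).
Local Notation st := (ustar S).
Local Notation sp := (@usp R B).

Lemma uinv_near x y z : uinverse x y -> N (x - z) * N y < 1 -> uinv z.
Proof.
move=> [xy yx] h.
have [|w [hw _]] := @neumann _ _ S (y * (x - z)).
  by rewrite (le_lt_trans (unormM _ _ _)) // mulrC.
have -> : z = x * (1 - y * (x - z)).
  by rewrite mulrBr mulr1 mulrA xy mul1r opprB addrC subrK.
by apply: uinvM; [exists y|exists w].
Qed.

Definition real_spectrum b : set R := [set s : R | sp b s%:C].

Lemma real_spectrum_compact b : compact (real_spectrum b).
Proof.
apply: (@subclosed_compact _ _ `[- N b, N b]%classic); last 1 first.
- move=> s /(usp_norm S); rewrite rnorm_real /= in_itv /= ler_norml.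
  by [].
- rewrite -openC openE => s /= /contrapT [y hy].
  have d0 : 0 < (N y + 1)^-1 by rewrite invr_gt0 ltr_pwDr ?unorm_ge0.
  apply/nbhs_ballP; exists (N y + 1)^-1 => //= r; rewrite /ball /= => hr hr'.
  apply: hr'; apply: (uinv_near hy).
  rewrite opprB addrA subrK -scalerBl -rmorphB /= unorm_alg rnorm_real.
  have := unorm_ge0 S y; rewrite -div1r ltr_pdivlMr ?ltr_pwDr ?unorm_ge0 // in hr.
  by have := normr_ge0 (s - r); lra.
- exact: segment_compact.
Qed.

Definition continuous_sp b f := forall l e, sp b l -> 0 < e ->
  exists2 d : R, 0 < d & forall l', sp b l' -> rnorm (l - l') <= d -> rnorm (f l - f l') <= e.

Lemma poly_dense b f (e : R) : st b = b -> continuous_sp b f -> 0 < e ->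
  exists p, forall l, sp b l -> rnorm (p.[l] - f l) <= e.
Proof.
move=> sb hf e0.
have [p hp] : exists p : {poly R[i]}, forall s, real_spectrum b s ->
    rnorm (p.[s%:C] - f s%:C) <= e.
  apply: (@weierstrass _ _ (fun s => f s%:C) _ _ (N b + 1)) => //.
  - exact: real_spectrum_compact.
  - move=> s c hs c0; have [d d0 hd] := hf _ _ hs c0.
    exists d => // r hr hsr; apply: hd => //.
    by rewrite -rmorphB /= rnorm_real.
  - have [l hl _] := usp_radius sb; exists (complex.Re l).
    by rewrite /real_spectrum /= -(usp_real sb hl).
  - by rewrite ltr_pwDr // unorm_ge0.
  - by move=> s /(usp_norm S); rewrite rnorm_real; lra.
by exists p => l hl; rewrite (usp_real sb hl) hp // /real_spectrum /= -(usp_real sb hl).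
Qed.

Lemma continuous_sp_real b (phi : R -> R) : continuous phi ->
  continuous_sp b (fun l => (phi (complex.Re l))%:C).
Proof.
move=> hc l e hl e0.
have /cvgrPdist_le/(_ e e0)/nbhs_ballP[d /= d0 hd] := hc (complex.Re l).
exists (d / 2); first by rewrite divr_gt0.
move=> m hm hlm; rewrite -rmorphB /= rnorm_real; apply: hd.
rewrite /ball /= -raddfB; apply: (le_lt_trans (Re_le_rnorm _)).
by apply: (le_lt_trans hlm); lra.
Qed.

(* [y = f(b)] for a self-adjoint [b], as a relation: [y] is the limit of [p(b)]
   when the polynomials [p] converge to [f] uniformly on the spectrum. *)
Definition fcalc b f y := forall e : R, 0 < e ->
  exists p, (forall l, sp b l -> rnorm (p.[l] - f l) <= e) /\
            N (horner_alg b p - y) <= e.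

Lemma fcalc_ext b f g y : (forall l, sp b l -> f l = g l) ->
  fcalc b f y -> fcalc b g y.
Proof.
move=> fg h e e0; have [p [h1 h2]] := h e e0; exists p; split=> // l hl.
by rewrite -fg ?h1.
Qed.

Lemma fcalc_poly b p : fcalc b (fun l => p.[l]) (horner_alg b p).
Proof.
move=> e e0; exists p; split=> [l _|]; rewrite subrr.
  by rewrite rnorm0 ltW.
by rewrite unorm0 ltW.
Qed.

Lemma fcalc_id b : fcalc b id b.
Proof.
rewrite -{2}(horner_algX b); apply: fcalc_ext (@fcalc_poly _ _) => l _.
by rewrite hornerX.
Qed.

Lemma fcalc_cst b l : fcalc b (fun=> l) l%:A.
Proof.
rewrite -(horner_algC b); apply: fcalc_ext (@fcalc_poly _ _) => m _.
by rewrite hornerC.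
Qed.

Lemma fcalc_norm b f y (c : R) : st b = b -> fcalc b f y ->
  (forall l, sp b l -> rnorm (f l) <= c) -> N y <= c.
Proof.
move=> sb h hc; rewrite -subr_le0; apply: (@ler0_mul_eps _ 2) => e e0.
have [p [h1 h2]] := h e e0.
have : N (horner_alg b p) <= c + e.
  apply: unorm_horner_alg sb _ => l hl.
  have := rnormD (p.[l] - f l) (f l); rewrite subrK.
  by have := h1 l hl; have := hc l hl; lra.
by have := unormB S (horner_alg b p) (horner_alg b p - y); rewrite opprB addrC subrK; lra.
Qed.

(** Since [p.[l]] lies in the spectrum of [p(b)], the norm of [y] bounds [f] on the spectrum;
    [fcalcM] relies on this bound. *)
Lemma fcalc_bound b f y l : fcalc b f y -> sp b l -> rnorm (f l) <= N y.
Proof.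
move=> h hl; rewrite -subr_le0; apply: (@ler0_mul_eps _ 2) => e e0.
have [p [h1 h2]] := h e e0.
have := rnormB p.[l] (p.[l] - f l); rewrite opprB addrC subrK.
have := h1 l hl; have := rnorm_horner_le S p hl.
by have := unormD S (horner_alg b p - y) y; rewrite subrK; lra.
Qed.

Lemma fcalcD b f g y z : fcalc b f y -> fcalc b g z ->
  fcalc b (fun l => f l + g l) (y + z).
Proof.
move=> hf hg e e0; have e2 : 0 < e / 2 by rewrite divr_gt0.
have [p [p1 p2]] := hf _ e2; have [q [q1 q2]] := hg _ e2.
exists (p + q); split=> [l hl|].
  rewrite hornerD opprD addrACA (le_trans (rnormD _ _)) //.
  by have := p1 l hl; have := q1 l hl; lra.
by rewrite rmorphD opprD addrACA (le_trans (unormD _ _ _)) //; lra.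
Qed.

Lemma fcalcM b f g y z : fcalc b f y -> fcalc b g z ->
  fcalc b (fun l => f l * g l) (y * z).
Proof.
move=> hf hg e e0.
have Y0 := unorm_ge0 S y; have Z0 := unorm_ge0 S z.
have D0 : 0 < N y + N z + 1 by lra.
pose c := Num.min 1 (e / (N y + N z + 1)).
have c0 : 0 < c by rewrite lt_min ltr01 divr_gt0.
have c1 : c <= 1 by rewrite ge_min lexx.
have ce : c * (N y + N z + 1) <= e by rewrite -ler_pdivlMr // ge_min lexx orbT.
(* The same estimate is used for functions on the spectrum and for elements of the algebra. *)
have key (Y Z P' Q' W : R) : 0 <= Y <= N y -> 0 <= Z <= N z -> 0 <= P' <= c -> 0 <= Q' <= c ->
    W <= P' * Z + Y * Q' + P' * Q' -> W <= e.
  move=> /andP[? ?] /andP[? ?] /andP[? ?] /andP[? ?] hW; apply: (le_trans hW).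
  have : P' * Z <= c * N z by rewrite ler_pM.
  have : Y * Q' <= N y * c by rewrite ler_pM.
  have : P' * Q' <= c * 1 by rewrite ler_pM //; lra.
  by lra.
have [p [p1 p2]] := hf _ c0; have [q [q1 q2]] := hg _ c0.
exists (p * q); split=> [l hl|].
  apply: (key (rnorm (f l)) (rnorm (g l)) (rnorm (p.[l] - f l)) (rnorm (q.[l] - g l))).
  - by rewrite rnorm_ge0 (fcalc_bound hf).
  - by rewrite rnorm_ge0 (fcalc_bound hg).
  - by rewrite rnorm_ge0 p1.
  - by rewrite rnorm_ge0 q1.
  have -> : (p * q).[l] - f l * g l =
    (p.[l] - f l) * g l + f l * (q.[l] - g l) + (p.[l] - f l) * (q.[l] - g l).
    by rewrite hornerM; ring.
  by rewrite (le_trans (rnormD _ _)) // -!rnormM lerD2r rnormD.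
apply: (key (N y) (N z) (N (horner_alg b p - y)) (N (horner_alg b q - z))).
- by rewrite Y0 lexx.
- by rewrite Z0 lexx.
- by rewrite unorm_ge0.
- by rewrite unorm_ge0.
rewrite rmorphM /=; set P' := horner_alg b p; set Q' := horner_alg b q.
have -> : P' * Q' - y * z = (P' - y) * z + y * (Q' - z) + (P' - y) * (Q' - z).
  rewrite addrAC -mulrDr [z + _]addrC subrK.
  by rewrite mulrBl mulrBr addrA subrK.
rewrite (le_trans (unormD _ _ _)) // lerD ?unormM //.
by rewrite (le_trans (unormD _ _ _)) // lerD ?unormM.
Qed.

Lemma fcalcZ b l f y : fcalc b f y -> fcalc b (fun m => l * f m) (l *: y).
Proof. by move=> h; rewrite -mulr_algl; apply: fcalcM h; exact: fcalc_cst. Qed.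

Lemma fcalcN b f y : fcalc b f y -> fcalc b (fun m => - f m) (- y).
Proof.
move=> h; rewrite -scaleN1r; apply: fcalc_ext (fcalcZ (-1) h) => l _.
by rewrite mulN1r.
Qed.

Lemma fcalcB b f g y z : fcalc b f y -> fcalc b g z ->
  fcalc b (fun l => f l - g l) (y - z).
Proof. by move=> hf hg; apply: fcalcD hf _; exact: fcalcN. Qed.

Lemma fcalc_uniq b f g y z : st b = b -> fcalc b f y -> fcalc b g z ->
  (forall l, sp b l -> f l = g l) -> y = z.
Proof.
move=> sb hf hg fg; apply/eqP; rewrite -subr_eq0; apply/eqP.
apply: (@unorm_eq0 _ _ S); apply: le_anti; rewrite unorm_ge0 andbT.
by apply: (fcalc_norm sb (fcalcB hf hg)) => l /fg ->; rewrite subrr rnorm0.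
Qed.

Lemma fcalc_exists b f : st b = b -> continuous_sp b f -> exists y, fcalc b f y.
Proof.
move=> sb hf.
have pe n : 0 < n.+1%:R^-1 :> R by rewrite invr_gt0.
have [p hp] := choice (fun n => poly_dense sb hf (pe n)).
have inv_small (e : R) : 0 < e -> exists n, forall m, (n <= m)%N -> m.+1%:R^-1 <= e.
  move=> e0; exists (Num.truncn e^-1) => m nm.
  rewrite -[leRHS]invrK lef_pV2 ?posrE ?invr_gt0 //.
  by apply: (le_trans (ltW (truncnS_gt _))); rewrite ler_nat.
have dpq n m : N (horner_alg b (p n) - horner_alg b (p m)) <= n.+1%:R^-1 + m.+1%:R^-1.
  rewrite -rmorphB; apply: unorm_horner_alg sb _ => l hl; rewrite hornerD hornerN.
  have := rnormB ((p n).[l] - f l) ((p m).[l] - f l); rewrite opprB addrA subrK.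
  by move=> /le_trans; apply; rewrite lerD // hp.
have [y hy] : exists y, forall e, 0 < e ->
    exists n, forall m, (n <= m)%N -> N (horner_alg b (p m) - y) <= e.
  apply: (@ucomplete _ _ S (fun n => horner_alg b (p n))) => e e0.
  have [n hn] := inv_small _ (divr_gt0 e0 (ltr0n R 2)).
  exists n => m nm; apply: (le_trans (dpq _ _)).
  by rewrite (splitr e) lerD // hn.
exists y => e e0; have [n hn] := hy e e0; have [m hm] := inv_small e e0.
exists (p (n + m)%N); split; last by rewrite hn ?leq_addr.
by move=> l hl; apply: (le_trans (hp _ l hl)); rewrite hm ?leq_addl.
Qed.

Lemma fcalc_star b f y : st b = b -> fcalc b f y -> fcalc b (fun l => (f l)^*) (st y).
Proof.
move=> sb h e e0; have [p [h1 h2]] := h e e0.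
exists (map_poly Num.conj p); split=> [l hl|].
  have {1}<- : l^* = l by rewrite (usp_real sb hl); exact: conjc_real.
  by rewrite horner_map /= -rmorphB rnorm_conj h1.
by rewrite -(@horner_alg_star _ _ S) // -ustarB unorm_star.
Qed.

Lemma fcalc_sa b f y : st b = b -> fcalc b f y ->
  (forall l, sp b l -> complex.Im (f l) = 0) -> st y = y.
Proof.
move=> sb h hf; apply: (fcalc_uniq sb (fcalc_star sb h) h) => l /hf /real_complex_Re ->.
exact: conjc_real.
Qed.

(** Invertibility is an open condition: an inverse [w] of [f l - y] would make [p.[l] - p(b)]
    invertible for a polynomial [p] close to [f], against [usp_horner_alg]. *)
Lemma fcalc_usp b f y l : fcalc b f y -> sp b l -> sp y (f l).
Proof.
move=> h hl [w hw].
have W0 := unorm_ge0 S w.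
have c0 : 0 < (2 * (N w + 1))^-1 by rewrite invr_gt0 mulr_gt0 // ltr_pwDr.
have [p [h1 h2]] := h _ c0.
apply: (usp_horner_alg (p := p) hl); apply: (uinv_near hw).
rewrite [X in N X](_ : _ = (horner_alg b p - y) - (p.[l] - f l)%:A).
  have := unormB S (horner_alg b p - y) (p.[l] - f l)%:A; rewrite unorm_alg.
  have := h1 l hl; move: h2; set c := _^-1 => k1 k2 k3.
  have k4 : N (horner_alg b p - y - (p.[l] - f l)%:A) <= 2 * c by lra.
  apply: (le_lt_trans (ler_wpM2r W0 k4)).
  have : c * (2 * (N w + 1)) = 1 by rewrite mulVf // lt0r_neq0 // mulr_gt0 // ltr_pwDr.
  by nra.
by rewrite scalerBl !opprB addrACA [RHS]addrACA [X in X + _]addrC.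
Qed.

Lemma fcalc_horner b f y p : fcalc b f y ->
  fcalc b (fun l => p.[f l]) (horner_alg y p).
Proof.
move=> h; elim/poly_ind: p => [|p c ih].
  have -> : horner_alg y 0 = (0 : R[i])%:A by rewrite rmorph0 scale0r.
  by apply: fcalc_ext (@fcalc_cst b 0) => l _; rewrite horner0.
rewrite rmorphD rmorphM /= horner_algX horner_algC.
apply: fcalc_ext (fcalcD (fcalcM ih h) (@fcalc_cst _ c)) => l _.
by rewrite !hornerE.
Qed.

(** Approximate [g] by [p] on the spectrum of [y], which contains the values of [f] by [fcalc_usp],
    and then [p] composed with [f] by a polynomial in [b]. It serves to compute iterated
    cutdowns. *)
Lemma fcalc_comp b f y g z : fcalc b f y -> fcalc y g z ->
  fcalc b (fun l => g (f l)) z.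
Proof.
move=> hf hg e e0; have e2 : 0 < e / 2 by rewrite divr_gt0.
have [p [p1 p2]] := hg _ e2.
have [q [q1 q2]] := fcalc_horner p hf e2.
exists q; split=> [l hl|].
  have := rnormD (q.[l] - p.[f l]) (p.[f l] - g (f l)); rewrite addrA subrK.
  by have := q1 l hl; have := p1 _ (fcalc_usp hf hl); lra.
have := unorm_tri S (horner_alg y p) (horner_alg b q) z.
by lra.
Qed.

End FunctionalCalculus.

(** The spectrum is bounded, so polynomials are Lipschitz on it, with a constant obtained along
    Horner's scheme. *)
Lemma continuous_sp_horner (R : realType) (B : algType R[i]) (S : ucstar B) (b : B)
  (p : {poly R[i]}) : continuous_sp b (horner p).
Proof.
have [L L0 hL] : exists2 L : R, 0 <= L & forall l m, usp b l -> usp b m ->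
    rnorm (p.[l] - p.[m]) <= L * rnorm (l - m).
  elim/poly_ind: p => [|p c [L L0 hL]].
    by exists 0 => // l m _ _; rewrite !horner0 subrr rnorm0 mul0r.
  exists (L * unorm S b + unorm S (horner_alg b p)).
    by rewrite addr_ge0 ?mulr_ge0 ?unorm_ge0.
  move=> l m hl hm; rewrite !hornerMXaddC opprD addrACA subrr addr0.
  have -> : p.[l] * l - p.[m] * m = (p.[l] - p.[m]) * l + p.[m] * (l - m) by ring.
  rewrite (le_trans (rnormD _ _)) // !rnormM mulrDl lerD //.
    rewrite mulrAC ler_pM ?rnorm_ge0 ?(usp_norm S hl) //; exact: hL.
  by rewrite ler_wpM2r ?rnorm_ge0 ?rnorm_horner_le.
move=> l e hl e0; exists (e / (L + 1)); first by rewrite divr_gt0 // ltr_pwDr.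
move=> m hm hlm; apply: (le_trans (hL _ _ hl hm)).
apply: (@le_trans _ _ ((L + 1) * rnorm (l - m))).
  by rewrite ler_wpM2r ?rnorm_ge0 // lerDl.
by rewrite -ler_pdivlMl ?ltr_pwDr // mulrC.
Qed.

(** * Positive elements *)

Section Positive.
Context {R : realType} {B : algType R[i]} (S : ucstar B).
Implicit Types (x y z b c : B) (l : R[i]) (p q : {poly R[i]}) (f g : R[i] -> R[i]).

Local Notation N := (unorm S).
Local Notation st := (ustar S).
Local Notation sp := (@usp R B).

Definition upos y := st y = y /\ forall l, sp y l -> 0 <= complex.Re l.

(** [fcalc_usp] maps the spectrum of [b] into that of [y], while the opposite inclusion would be
    wanted. A norm estimate replaces it: [0 <= f <= N y] on the spectrum gives [N (N y - y) <= N y],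
    which keeps the spectrum of [y] in the right half-plane. *)
Lemma fcalc_pos b f y : st b = b -> fcalc S b f y ->
  (forall l, sp b l -> complex.Im (f l) = 0 /\ 0 <= complex.Re (f l)) -> upos y.
Proof.
move=> sb h hf; have sy : st y = y by apply: (fcalc_sa sb h) => l /hf [].
split=> // l hl.
have hN : N ((N y)%:C%:A - y) <= N y.
  apply: (fcalc_norm sb (fcalcB (fcalc_cst S b (N y)%:C) h)) => m hm.
  have [/real_complex_Re fr f0] := hf m hm; have := fcalc_bound h hm.
  rewrite fr -rmorphB /= !rnorm_real ger0_norm // => hle.
  by rewrite ger0_norm ?subr_ge0 // lerBlDr lerDl.
have : sp ((N y)%:C%:A - y) ((N y)%:C - l).
  rewrite /usp /= scalerBl opprB addrC addrA subrK => hu; apply: hl.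
  by rewrite -opprB; exact: uinvN.
move=> /(usp_norm S) hl'.
have := Re_le_rnorm ((N y)%:C - l); rewrite raddfB /=.
by have := ler_norm (N y - complex.Re l); lra.
Qed.

(** With its converse [upos_of_norm], this turns positivity into a norm inequality, which passes to
    sums and limits. *)
Lemma upos_norm y (s : R) : upos y -> N y <= s -> N (s%:C%:A - y) <= s.
Proof.
move=> [sy hy] hs.
apply: (fcalc_norm sy (fcalcB (fcalc_cst S y s%:C) (fcalc_id S y))) => l hl.
rewrite (usp_real sy hl) -rmorphB /= rnorm_real.
have := usp_norm S hl; have := hy l hl; rewrite {2}(usp_real sy hl) rnorm_real => h1.
by rewrite ger0_norm // => h2; rewrite ger0_norm; lra.
Qed.

Lemma upos_of_norm y (s : R) : st y = y -> N (s%:C%:A - y) <= s -> upos y.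
Proof.
move=> sy hN; split=> // l hl.
have : sp (s%:C%:A - y) (s%:C - l).
  rewrite /usp /= scalerBl opprB addrC addrA subrK => hu; apply: hl.
  by rewrite -opprB; exact: uinvN.
move=> /(usp_norm S) hl'.
have := Re_le_rnorm (s%:C - l); rewrite raddfB /=.
by have := ler_norm (s - complex.Re l); lra.
Qed.

Lemma uposD y z : upos y -> upos z -> upos (y + z).
Proof.
move=> hy hz; apply: (@upos_of_norm _ (N y + N z)).
  by rewrite ustarD hy.1 hz.1.
rewrite rmorphD scalerDl opprD addrACA (le_trans (unormD _ _ _)) //.
by rewrite lerD // upos_norm.
Qed.

Lemma upos_closed y : (forall e : R, 0 < e -> exists2 z, upos z & N (z - y) <= e) -> upos y.
Proof.
move=> h.
have sy : st y = y.
  apply/eqP; rewrite -subr_eq0; apply/eqP; apply: (@unorm_small _ _ S 2) => e e0.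
  have [z [sz _] hz] := h e e0.
  have -> : st y - y = (z - y) - st (z - y) by rewrite ustarB sz opprB [RHS]addrC addrA subrK.
  by rewrite (le_trans (unormB _ _ _)) // unorm_star; lra.
apply: (@upos_of_norm _ (N y + 1)) => //.
rewrite -subr_le0; apply: (@ler0_mul_eps _ 1) => e e0.
have d0 : 0 < Num.min 1 e by rewrite lt_min ltr01.
have [z pz hz] := h _ d0.
have h1 : N (z - y) <= 1 by apply: le_trans hz _; rewrite ge_min lexx.
have h2 : N (z - y) <= e by apply: le_trans hz _; rewrite ge_min lexx orbT.
have h3 : N z <= N y + 1 by have := unormD S (z - y) y; rewrite subrK; lra.
have := upos_norm pz h3; have := unorm_tri S z ((N y + 1)%:C%:A) y.
by lra.
Qed.

Lemma upos_sqr z : st z = z -> upos (z * z).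
Proof.
move=> sz; split; first by rewrite ustarM sz.
move=> l hl; have : sp (horner_alg z ('X * 'X)) l by rewrite rmorphM /= horner_algX.
move=> /(usp_horner_algP sz) [m hm ->].
by rewrite hornerM hornerX (usp_real sz hm) -rmorphM /= -expr2 sqr_ge0.
Qed.

Lemma upos_antisym y : upos y -> upos (- y) -> y = 0.
Proof.
move=> [sy hy] [_ hNy]; apply: (@unorm_eq0 _ _ S); apply: le_anti; rewrite unorm_ge0 andbT.
have [l hl hN] := usp_radius sy.
have h1 := hy l hl.
have h2 : 0 <= complex.Re (- l).
  apply: hNy; rewrite /usp /= scaleNr -opprD => hu; apply: hl.
  by have := uinvN hu; rewrite opprK.
apply: (le_trans hN); rewrite (usp_real sy hl) rnorm_real.
by rewrite raddfN /= in h2; rewrite ger0_norm //; lra.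
Qed.

Lemma continuous_pos_sqrt : continuous (fun s : R => Num.sqrt (Num.max s 0)).
Proof.
move=> s; apply: (@continuous_comp _ _ _ (fun s : R => Num.max s 0) Num.sqrt).
  by apply: continuous_max => //; exact: cvg_cst.
exact: sqrt_continuous.
Qed.

Lemma upos_sqrt y : upos y -> exists z, [/\ st z = z, z * z = y &
  fcalc S y (fun l => (Num.sqrt (Num.max (complex.Re l) 0))%:C) z].
Proof.
move=> [sy hy].
have [z hz] := fcalc_exists sy (continuous_sp_real (b := y) continuous_pos_sqrt).
exists z; split=> //; first exact: (fcalc_sa sy hz).
apply: (fcalc_uniq sy (fcalcM hz hz) (fcalc_id S y)) => l hl.
rewrite -rmorphM /= -expr2 sqr_sqrtr ?le_max ?lexx ?orbT //.
by rewrite max_l ?hy // -(usp_real sy hl).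
Qed.

(** Jacobson's formula: an inverse [w] of [l - y x] yields the inverse [l^-1 (1 + x w y)] of
    [l - x y]. *)
Lemma usp_mulC x y l : l != 0 -> sp (x * y) l -> sp (y * x) l.
Proof.
move=> l0 h [w [h1 h2]]; apply: h; exists (l^-1 *: (1 + x * w * y)).
have cx : (l%:A - x * y) * x = x * (l%:A - y * x).
  by rewrite mulrBl mulrBr mulr_algl mulr_algr mulrA.
have cy : y * (l%:A - x * y) = (l%:A - y * x) * y.
  by rewrite mulrBl mulrBr mulr_algl mulr_algr mulrA.
split.
  rewrite -scalerAr mulrDr mulr1 !mulrA cx -(mulrA x) h1 mulr1 subrK.
  by rewrite scalerA mulVf // scale1r.
rewrite -scalerAl mulrDl mul1r -!mulrA cy (mulrA w) h2 mul1r subrK.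
by rewrite scalerA mulVf // scale1r.
Qed.

(** Kaplansky's argument. With [m] the negative part of [c] and [w = x * m], the element [st w * w]
    equals [- m ^+ 3], hence is negative; by [usp_mulC] so is [w * st w]. But for [w = u + i v] with
    [u], [v] self-adjoint, the two products add up to [2 (u^2 + v^2)], so [st w * w] is also
    positive and vanishes. This excludes negative points from the spectrum of [c]. *)
Lemma uposM x : upos (st x * x).
Proof.
pose c := st x * x; have sc : st c = c by exact: ustar_saM.
pose phi (s : R) := Num.max (- s) 0.
have cphi : continuous phi.
  move=> s; apply: continuous_max; last exact: cvg_cst.
  exact: opp_continuous.
(* The power 3/2 of [phi]: it makes [z * z] the cube of [m], so that [st w * w] is visibly minus a
   square. *)
pose psi (s : R) := phi s * Num.sqrt (phi s).
have cpsi : continuous psi.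
  move=> s; apply: continuousM; first exact: cphi.
  apply: (@continuous_comp _ _ _ phi Num.sqrt); first exact: cphi.
  exact: sqrt_continuous.
have phi0 s : 0 <= phi s by rewrite le_max lexx orbT.
have [m hm] := fcalc_exists sc (continuous_sp_real (b := c) cphi).
have [z hz] := fcalc_exists sc (continuous_sp_real (b := c) cpsi).
have sm : st m = m by apply: (fcalc_sa sc hm).
have sz : st z = z by apply: (fcalc_sa sc hz).
pose w := x * m.
have wE : st w * w = - (z * z).
  rewrite /w ustarM sm mulrA -(mulrA m) -/c.
  apply: (fcalc_uniq sc (fcalcM (fcalcM hm (fcalc_id S c)) hm) (fcalcN (fcalcM hz hz))).
  move=> l hl; rewrite /psi [X in _ * X * _](usp_real sc hl) -!rmorphM -rmorphN /=.
  congr (_%:C); rewrite mulrACA -expr2 -[Num.sqrt _ * _]expr2 sqr_sqrtr //.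
  rewrite /phi; case: (leP (- complex.Re l) 0) => h; first by ring.
  by ring.
have p1 : upos (- (w * st w)).
  split; first by rewrite ustarN ustarM ustarK.
  move=> l hl; have [->|l0] := eqVneq l 0; first by [].
  have hl' : sp (w * - st w) l by rewrite mulrN.
  have := usp_mulC l0 hl'; rewrite mulNr wE opprK => hl2.
  exact: (upos_sqr sz).2.
pose u := 2^-1 *: (w + st w); pose v := (2 * 'i)^-1 *: (w - st w).
have su : st u = u.
  rewrite ustarZ ustarD ustarK addrC; congr (_ *: _).
  by rewrite fmorphV rmorph_nat.
have sv : st v = v.
  rewrite /v ustarZ ustarB ustarK -opprB scalerN -scaleNr; congr (_ *: _).
  by rewrite fmorphV rmorphM rmorph_nat /= conjCi mulrN invrN opprK.
have e : st w * w = (u * u + u * u + (v * v + v * v)) + (- (w * st w)).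
  set s := st w.
  have hu : u * u = 4^-1 *: ((w + s) * (w + s)).
    by rewrite -scalerAl -scalerAr scalerA -invfM -natrM.
  have hv : v * v = - (4^-1 *: ((w - s) * (w - s))).
    rewrite -scalerAl -scalerAr scalerA -invfM mulrACA -natrM -expr2 sqrCi.
    by rewrite mulrN1 invrN scaleNr.
  have hd : (w + s) * (w + s) - (w - s) * (w - s) = (w * s + s * w) *+ 2.
    have -> : w * s + s * w = (w + s) * s + s * (w - s).
      by rewrite mulrDl mulrBr [s * w - _]addrC addrA addrK.
    have ds : (w + s) - (w - s) = s *+ 2 by rewrite opprB addrC addrA subrK mulr2n.
    have gen (a a' : B) : a * a - a' * a' = a * (a - a') + (a - a') * a'.
      by rewrite mulrBr mulrBl addrA subrK.
    by rewrite gen ds mulrnDl mulrnAr mulrnAl.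
  have -> : u * u + u * u + (v * v + v * v) = 2^-1 *: ((w * s + s * w) *+ 2).
    rewrite addrACA -hd hu hv -scalerBr -scalerDl; congr (_ *: _).
    by field.
  by rewrite -(@scaler_nat R[i] B) scalerA mulVf ?pnatr_eq0 // scale1r addrAC subrr add0r.
have p2 : upos (st w * w).
  by rewrite e; do !apply: uposD => //; exact: upos_sqr.
have w0 : z * z = 0.
  by apply: upos_antisym; [exact: upos_sqr|rewrite -wE].
split=> // l hl; rewrite leNgt; apply/negP => l0.
have z0 : N z = 0.
  have := unorm_sa sz; rewrite w0 unorm0 => /esym/eqP.
  by rewrite sqrf_eq0 => /eqP.
have := fcalc_bound hz hl; rewrite z0 rnorm_real /psi /phi.
rewrite max_l; last by rewrite oppr_ge0 ltW.
by rewrite normr_le0 mulf_eq0 oppr_eq0 (lt_eqF l0) /= sqrtr_eq0 oppr_le0 leNgt l0.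
Qed.

End Positive.

(** * The unitization *)

Section Unitization.
Context {R : realType} (A : cstarAlgType R).

Definition unitz : Type := (A * R[i]^o)%type.

HB.instance Definition _ := GRing.Lmodule.on unitz.

Implicit Types (u v w : unitz) (a x y : A) (l : R[i]).

Definition uone : unitz := (0, 1).

Lemma cmul0l x : cmul 0 x = 0.
Proof. by apply: (@addrI _ (cmul 0 x)); rewrite -cmulDl !addr0. Qed.

Lemma cmul0r x : cmul x 0 = 0.
Proof. by apply: (@addrI _ (cmul x 0)); rewrite -cmulDr !addr0. Qed.

Lemma umulE u v : umul u v = (cmul u.1 v.1 + u.2 *: v.1 + v.2 *: u.1, u.2 * v.2).
Proof. by []. Qed.

Lemma umulA : associative (@umul R A : unitz -> unitz -> unitz).
Proof.
move=> [a l] [b m] [c n]; rewrite !umulE /=; congr pair; last by rewrite mulrA.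
rewrite !cmulDl !cmulDr !cmulZl !cmulZr !scalerDr !scalerA cmulA.
rewrite [LHS](AC (3*3*1) ((1*4*2*5)*(3*6*7))) [n * l]mulrC [n * m]mulrC.
by [].
Qed.

Lemma umul1u : left_id uone (@umul R A : unitz -> unitz -> unitz).
Proof. by move=> [a l]; rewrite umulE /= cmul0l scale1r scaler0 addr0 add0r mul1r. Qed.

Lemma umulu1 : right_id uone (@umul R A : unitz -> unitz -> unitz).
Proof. by move=> [a l]; rewrite umulE /= cmul0r scale1r scaler0 addr0 add0r mulr1. Qed.

Lemma umulDl : left_distributive (@umul R A : unitz -> unitz -> unitz) +%R.
Proof.
move=> [a l] [b m] [c n]; rewrite !umulE /=; congr pair; last by rewrite mulrDl.
rewrite cmulDl scalerDl scalerDr /= [RHS]addrACA; congr (_ + _).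
by rewrite addrACA.
Qed.

Lemma umulDr : right_distributive (@umul R A : unitz -> unitz -> unitz) +%R.
Proof.
move=> [a l] [b m] [c n]; rewrite !umulE /=; congr pair; last by rewrite mulrDr.
rewrite cmulDr scalerDl scalerDr /= [RHS]addrACA; congr (_ + _).
by rewrite addrACA.
Qed.

Lemma uone_neq0 : uone != 0.
Proof. by apply/eqP => -[/eqP]; rewrite oner_eq0. Qed.

HB.instance Definition _ :=
  GRing.Zmodule_isNzRing.Build unitz umulA umul1u umulu1 umulDl umulDr uone_neq0.

Lemma unitz_mulE u v :
  u * v = (cmul u.1 v.1 + u.2 *: v.1 + v.2 *: u.1, u.2 * v.2) :> unitz.
Proof. by []. Qed.

Lemma unitz_scaleE l u : l *: u = (l *: u.1, l * u.2) :> unitz.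
Proof. by []. Qed.

Lemma uscaleAl l u v : l *: (u * v) = (l *: u) * v.
Proof.
rewrite !unitz_scaleE !unitz_mulE /=; congr pair; last by rewrite mulrA.
by rewrite !scalerDr cmulZl !scalerA [v.2 * l]mulrC.
Qed.

HB.instance Definition _ := GRing.Lmodule_isLalgebra.Build R[i] unitz uscaleAl.

Lemma uscaleAr l u v : l *: (u * v) = u * (l *: v).
Proof.
rewrite !unitz_scaleE !unitz_mulE /=; congr pair; last by rewrite mulrCA.
by rewrite !scalerDr cmulZr !scalerA [u.2 * l]mulrC.
Qed.

HB.instance Definition _ := GRing.Lalgebra_isAlgebra.Build R[i] unitz uscaleAr.

Lemma unitz_oneE : 1 = (0, 1) :> unitz. Proof. by []. Qed.

Lemma unitz_algE l : l%:A = (0, l) :> unitz.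
Proof. by rewrite unitz_scaleE unitz_oneE /= scaler0 mulr1. Qed.

(** Left multiplication on the ideal [A]. Its operator norm [uop] satisfies the C*-identity, which
    the sum of the norms of the components fails in general. *)
Definition uact u x := cmul u.1 x + u.2 *: x.

Lemma uactM u v x : uact (u * v) x = uact u (uact v x).
Proof.
rewrite /uact unitz_mulE /= !cmulDl !cmulDr cmulZl cmulZl cmulZr cmulA scalerDr.
rewrite scalerA -!addrA; congr (_ + _).
by rewrite addrCA.
Qed.

Lemma uactD u v x : uact (u + v) x = uact u x + uact v x.
Proof. by rewrite /uact /= cmulDl scalerDl addrACA. Qed.

Lemma uactZr u l x : uact u (l *: x) = l *: uact u x.
Proof. by rewrite /uact cmulZr scalerDr !scalerA mulrC. Qed.

Lemma uactZl u l x : uact (l *: u) x = l *: uact u x.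
Proof. by rewrite /uact unitz_scaleE /= cmulZl scalerDr scalerA. Qed.

Lemma rnorm_cmul x y : rnorm (cmul x y) <= rnorm x * rnorm y.
Proof. by rewrite -lecR rmorphM /= -!rnormE norm_cmul_le. Qed.

Lemma rnorm_star_cmul x : rnorm (cmul (star x) x) = rnorm x ^+ 2.
Proof. by apply: complexI; rewrite rmorphXn /= -!rnormE norm_star_cmul. Qed.

Lemma rnorm_star x : rnorm (star x) = rnorm x.
Proof.
have h y : rnorm y <= rnorm (star y).
  have [->|y0] := eqVneq (rnorm y) 0; first exact: rnorm_ge0.
  have y1 : 0 < rnorm y by rewrite lt0r y0 rnorm_ge0.
  by rewrite -(ler_pM2r y1) -expr2 -rnorm_star_cmul rnorm_cmul.
by apply: le_anti; rewrite h -{2}(starK x) h.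
Qed.

Definition uop_set u : set R := [set rnorm (uact u x) | x in [set x | rnorm x <= 1]].
Definition uop u : R := sup (uop_set u).

Lemma uop_set_has_sup u : has_sup (uop_set u).
Proof.
split; first by exists (rnorm (uact u 0)), 0 => //=; rewrite rnorm0.
exists (rnorm u.1 + rnorm u.2) => _ [x /= x1 <-].
rewrite (le_trans (rnormD _ _)) // rnormZ lerD //.
  by rewrite (le_trans (rnorm_cmul _ _)) // ler_piMr // rnorm_ge0.
by rewrite ler_piMr // rnorm_ge0.
Qed.

Lemma uop_ge0 u : 0 <= uop u.
Proof.
apply: (@le_trans _ _ (rnorm (uact u 0))); first exact: rnorm_ge0.
apply: ub_le_sup; first exact: (uop_set_has_sup u).2.
by exists 0 => //=; rewrite rnorm0.
Qed.

Lemma uact_le u x : rnorm (uact u x) <= uop u * rnorm x.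
Proof.
have [x0|x0] := eqVneq (rnorm x) 0.
  by rewrite x0 mulr0 (rnorm_eq0 x0) /uact cmul0r scaler0 addr0 rnorm0.
have xp : 0 < rnorm x by rewrite lt0r x0 rnorm_ge0.
have rx : rnorm ((rnorm x)^-1)%:C = (rnorm x)^-1.
  by rewrite rnorm_real ger0_norm // invr_ge0 ltW.
rewrite -ler_pdivrMr // mulrC -rx -rnormZ -uactZr.
apply: ub_le_sup; first exact: (uop_set_has_sup u).2.
by exists (((rnorm x)^-1)%:C *: x) => //=; rewrite rnormZ rx mulVf.
Qed.

Lemma uop_le u (c : R) : (forall x, rnorm (uact u x) <= c * rnorm x) -> 0 <= c ->
  uop u <= c.
Proof.
move=> h c0; apply: sup_le_ub; first exact: (uop_set_has_sup u).1.
by move=> _ [x /= x1 <-]; rewrite (le_trans (h x)) // ler_piMr.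
Qed.

Lemma uopD u v : uop (u + v) <= uop u + uop v.
Proof.
apply: uop_le => [x|]; last by rewrite addr_ge0 // uop_ge0.
by rewrite uactD (le_trans (rnormD _ _)) // mulrDl lerD // uact_le.
Qed.

Lemma uopM u v : uop (u * v) <= uop u * uop v.
Proof.
apply: uop_le => [x|]; last by rewrite mulr_ge0 // uop_ge0.
rewrite uactM (le_trans (uact_le _ _)) // -mulrA ler_wpM2l ?uop_ge0 //.
exact: uact_le.
Qed.

Lemma uopZ_le l u : uop (l *: u) <= rnorm l * uop u.
Proof.
apply: uop_le => [x|]; last by rewrite mulr_ge0 ?rnorm_ge0 ?uop_ge0.
by rewrite uactZl rnormZ -mulrA ler_wpM2l ?rnorm_ge0 // uact_le.
Qed.

Definition uadj u : unitz := (star u.1, (u.2)^*).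

Lemma uadjK : involutive uadj.
Proof. by move=> [a l]; rewrite /uadj /= starK conjCK. Qed.

Lemma uadjD : {morph uadj : u v / u + v}.
Proof. by move=> u v; rewrite /uadj /= starD rmorphD. Qed.

Lemma uadjZ l u : uadj (l *: u) = l^* *: uadj u.
Proof. by rewrite unitz_scaleE /uadj /= starZ rmorphM. Qed.

Lemma uadjM u v : uadj (u * v) = uadj v * uadj u.
Proof.
rewrite !unitz_mulE /uadj /= !starD starM !starZ rmorphM /=.
by congr (_, _); [rewrite addrAC|rewrite mulrC].
Qed.

Lemma star_uact u x y : cmul (star (uact u x)) y = cmul (star x) (uact (uadj u) y).
Proof.
by rewrite /uact starD starM starZ cmulDl cmulDr cmulZl cmulZr cmulA.
Qed.

(** The C*-identity of [A] transports: the squared norm of [u x] is that of [x^* (u^* u x)], at most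
    [uop (uadj u * u)] times the squared norm of [x]. *)
Lemma uop_cstar_le u : uop u ^+ 2 <= uop (uadj u * u).
Proof.
rewrite -(sqr_sqrtr (uop_ge0 (uadj u * u))) ler_pXn2r ?nnegrE ?uop_ge0 ?sqrtr_ge0 //.
apply: uop_le; last exact: sqrtr_ge0.
move=> x; rewrite -(@ler_pXn2r _ 2) ?nnegrE ?rnorm_ge0 ?mulr_ge0 ?sqrtr_ge0 ?rnorm_ge0 //.
rewrite -rnorm_star_cmul star_uact -uactM exprMn sqr_sqrtr ?uop_ge0 //.
rewrite (le_trans (rnorm_cmul _ _)) // rnorm_star mulrC expr2 mulrA ler_wpM2r ?rnorm_ge0 //.
exact: uact_le.
Qed.

Lemma uop_adj u : uop (uadj u) = uop u.
Proof.
have h v : uop v <= uop (uadj v).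
  have [->|y0] := eqVneq (uop v) 0; first exact: uop_ge0.
  have y1 : 0 < uop v by rewrite lt0r y0 uop_ge0.
  rewrite -(ler_pM2r y1) -expr2 (le_trans (uop_cstar_le v)) //; exact: uopM.
by apply: le_anti; rewrite h -{2}(uadjK u) h.
Qed.

Lemma uop_cstar u : uop (uadj u * u) = uop u ^+ 2.
Proof.
apply: le_anti; rewrite uop_cstar_le andbT.
by have := uopM (uadj u) u; rewrite uop_adj.
Qed.

(* The operator norm alone is only a seminorm when [A] has a unit. *)
Definition unitz_norm u : R := Num.max (uop u) (rnorm (u.2 : R[i])).

Definition iota a : unitz := (a, 0).

(** Testing left multiplication by [a] on [star a] shows that no norm is lost. *)
Lemma uop_iota a : uop (iota a) = rnorm a.
Proof.
apply: le_anti; apply/andP; split.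
  apply: uop_le; last exact: rnorm_ge0.
  by move=> x; rewrite /uact /= scale0r addr0 rnorm_cmul.
have [->|y0] := eqVneq (rnorm a) 0; first exact: uop_ge0.
have y1 : 0 < rnorm a by rewrite lt0r y0 rnorm_ge0.
rewrite -(ler_pM2r y1) -expr2 -{1 2}(rnorm_star a) -rnorm_star_cmul starK.
by have := uact_le (iota a) (star a); rewrite /uact /= scale0r addr0.
Qed.

Lemma unitz_norm_iota a : unitz_norm (iota a) = rnorm a.
Proof. by rewrite /unitz_norm uop_iota rnorm0 max_l // rnorm_ge0. Qed.

Lemma unitz_norm_snd u : rnorm (u.2 : R[i]) <= unitz_norm u.
Proof. by rewrite le_max lexx orbT. Qed.

Lemma uop_norm u : uop u <= unitz_norm u.
Proof. by rewrite le_max lexx. Qed.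

Lemma unitz_norm_le u (c : R) : uop u <= c -> rnorm (u.2 : R[i]) <= c -> unitz_norm u <= c.
Proof. by rewrite /unitz_norm ge_max => -> ->. Qed.

Lemma unitz_normD u v : unitz_norm (u + v) <= unitz_norm u + unitz_norm v.
Proof.
apply: unitz_norm_le.
  by rewrite (le_trans (uopD _ _)) // lerD // uop_norm.
by rewrite (le_trans (rnormD _ _)) // lerD // unitz_norm_snd.
Qed.

Lemma unitz_norm_ge0 u : 0 <= unitz_norm u.
Proof. by rewrite le_max uop_ge0. Qed.

Lemma unitz_normM u v : unitz_norm (u * v) <= unitz_norm u * unitz_norm v.
Proof.
apply: unitz_norm_le.
  by rewrite (le_trans (uopM _ _)) // ler_pM ?uop_ge0 ?uop_norm.
by rewrite unitz_mulE /= rnormM ler_pM ?rnorm_ge0 ?unitz_norm_snd.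
Qed.

Lemma unitz_normZ l u : unitz_norm (l *: u) = rnorm l * unitz_norm u.
Proof.
have h m v : unitz_norm (m *: v) <= rnorm m * unitz_norm v.
  apply: unitz_norm_le.
    by rewrite (le_trans (uopZ_le _ _)) // ler_wpM2l ?rnorm_ge0 ?uop_norm.
  by rewrite unitz_scaleE /= rnormM ler_wpM2l ?rnorm_ge0 ?unitz_norm_snd.
apply: le_anti; rewrite h /=.
have [->|l0] := eqVneq l 0; first by rewrite rnorm0 mul0r unitz_norm_ge0.
have lp : 0 < rnorm l.
  rewrite lt0r rnorm_ge0 andbT; apply: contra l0 => /eqP/rnorm_eq0 ->.
  by [].
rewrite -ler_pdivlMl // -rnormV.
by have := h l^-1 (l *: u); rewrite scalerA mulVf // scale1r.
Qed.

(** A maximum of two C*-seminorms, the second one being the modulus of the character [u.2]. *)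
Lemma unitz_norm_cstar u : unitz_norm (uadj u * u) = unitz_norm u ^+ 2.
Proof.
rewrite /unitz_norm uop_cstar unitz_mulE /= rnormM rnorm_conj -expr2.
have [h|h] := leP (uop u) (rnorm (u.2 : R[i])).
  by rewrite max_r // ler_pXn2r // nnegrE ?uop_ge0 ?rnorm_ge0.
by rewrite max_l // ler_pXn2r ?nnegrE ?uop_ge0 ?rnorm_ge0 // ltW.
Qed.

Lemma unitz_norm_eq0 u : unitz_norm u = 0 -> u = 0.
Proof.
move=> u0; have h2 := unitz_norm_snd u; have h1 := uop_norm u.
rewrite u0 in h1 h2.
have u2 : u.2 = 0 by apply: rnorm_eq0; apply: le_anti; rewrite h2 rnorm_ge0.
have uE : u = iota u.1 by rewrite /iota -u2; case: (u).
rewrite uE uop_iota in h1.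
have u1 : u.1 = 0 by apply: rnorm_eq0; apply: le_anti; rewrite h1 rnorm_ge0.
by rewrite uE u1.
Qed.

Lemma unitz_norm1 : unitz_norm 1 = 1.
Proof.
have h : uop 1 <= 1.
  by apply: uop_le => // x; rewrite /uact /= cmul0l add0r scale1r mul1r.
by rewrite /unitz_norm /= rnorm_1 max_r.
Qed.

Lemma rnorm_fst u : rnorm u.1 <= 2 * unitz_norm u.
Proof.
rewrite -unitz_norm_iota.
have -> : iota u.1 = u - (u.2)%:A.
  by rewrite unitz_algE; case: u => a l; congr pair; rewrite /= ?subr0 ?subrr.
rewrite (le_trans (unitz_normD _ _)) // -scaleNr unitz_normZ rnormN.
by rewrite unitz_norm1 mulr1; have := unitz_norm_snd u; lra.
Qed.

Lemma normed_complete (K : numFieldType) (V : completeNormedModType K) (s : nat -> V) :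
  (forall e : K, 0 < e -> exists n, forall m, (n <= m)%N -> `|s m - s n| <= e) ->
  exists l : V, forall e : K, 0 < e -> exists n, forall m, (n <= m)%N -> `|s m - l| <= e.
Proof.
move=> h.
have cs : cvg (s @ \oo).
  apply: cauchy_cvg; apply: cauchy_exP => e e0.
  have [n hn] := h (e / 2) (divr_gt0 e0 (ltr0n _ 2)).
  exists (s n); exists n => // m /= nm; rewrite -ball_normE /= distrC.
  by apply: (le_lt_trans (hn _ nm)); rewrite ltr_pdivrMr // ltr_pMr // ltr1n.
exists (lim (s @ \oo)) => e e0.
have /cvgrPdist_le/(_ e e0) [n _ hn] := cs.
by exists n => m nm; rewrite distrC; exact: hn.
Qed.

Lemma unitz_complete (s : nat -> unitz) :
  (forall e : R, 0 < e -> exists n, forall m, (n <= m)%N -> unitz_norm (s m - s n) <= e) ->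
  exists w, forall e : R, 0 < e -> exists n, forall m, (n <= m)%N -> unitz_norm (s m - w) <= e.
Proof.
move=> h.
have [a ha] : exists a : A, forall e : R, 0 < e ->
    exists n, forall m, (n <= m)%N -> rnorm ((s m).1 - a) <= e.
  have [|a ha] := @normed_complete _ _ (fun n => (s n).1).
    move=> e e0; have er : e = (complex.Re e)%:C by apply: real_complex_Re; exact/ger0_Im/ltW.
    have e0' : 0 < complex.Re e by rewrite -ltcR -er.
    have [n hn] := h _ (divr_gt0 e0' (ltr0n _ 2)); exists n => m nm.
    rewrite rnormE er lecR.
    have := rnorm_fst (s m - s n); have := hn m nm; rewrite /=; lra.
  exists a => e e0; have [|n hn] := ha e%:C; first by rewrite ltcR.
  by exists n => m nm; rewrite -lecR -rnormE; exact: hn.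
(* The scalar component converges through its real and imaginary parts, which are Cauchy in [R]. *)
have cpl (f : R[i] -> R) : {morph f : x y / x - y} -> (forall x : R[i], `|f x| <= rnorm x) ->
    exists c : R, forall e : R, 0 < e ->
      exists n, forall m, (n <= m)%N -> `|f (s m).2 - c| <= e.
  move=> fB fle; apply: (@normed_complete R R^o (fun n => f (s n).2)) => e e0.
  have [n hn] := h _ e0; exists n => m nm; rewrite -fB (le_trans (fle _)) //.
  by rewrite (le_trans _ (hn _ nm)) //; exact: (unitz_norm_snd (s m - s n)).
have [c hc] := cpl _ (raddfB _) (@Re_le_rnorm R).
have [d hd] := cpl _ (raddfB _) (@Im_le_rnorm R).
exists (a, c +i* d) => e e0.
have e3 : 0 < e / 3 by rewrite divr_gt0.
have [n1 h1] := ha _ e3; have [n2 h2] := hc _ e3; have [n3 h3] := hd _ e3.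
exists (n1 + n2 + n3)%N => m nm.
have {}h1 := h1 m (leq_trans (leq_trans (leq_addr _ _) (leq_addr _ _)) nm).
have {}h2 := h2 m (leq_trans (leq_trans (leq_addl _ _) (leq_addr _ _)) nm).
have {}h3 := h3 m (leq_trans (leq_addl _ _) nm).
set v := s m - _.
have vE : v = iota v.1 + (v.2)%:A.
  by rewrite unitz_algE; case: (v) => x y; congr pair; rewrite /= ?addr0 ?add0r.
rewrite vE (le_trans (unitz_normD _ _)) // unitz_norm_iota.
have hv : unitz_norm (v.2)%:A <= `|complex.Re (s m).2 - c| + `|complex.Im (s m).2 - d|.
  rewrite unitz_normZ unitz_norm1 mulr1 (le_trans (rnorm_le_ReIm _)) //.
  by rewrite /v /= !raddfB.
have -> : v.1 = (s m).1 - a by [].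
by lra.
Qed.

Definition unitz_ucstar : ucstar unitz :=
  UCstar unitz_norm_ge0 unitz_norm_eq0 unitz_normD unitz_normZ unitz_normM
    unitz_norm_cstar uadjK uadjD uadjZ uadjM unitz_complete.

End Unitization.

(** * From the unitization back to [A] *)

Section Embedding.
Context {R : realType} {A : cstarAlgType R}.
Implicit Types (u v w : unitz A) (a b x y : A) (l : R[i]) (f g : R[i] -> R[i]).

Local Notation S := (unitz_ucstar A).
Local Notation sp := (@usp R (unitz A)).

Lemma iota_inj : injective (@iota R A).
Proof. by move=> a b []. Qed.

Lemma iotaM a b : iota (cmul a b) = iota a * iota b.
Proof. by rewrite unitz_mulE /iota /= !scale0r !addr0 mul0r. Qed.

Lemma iotaD a b : iota (a + b) = iota a + iota b.
Proof. by congr (_, _); rewrite addr0. Qed.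

Lemma iotaN a : iota (- a) = - iota a.
Proof. by congr (_, _); rewrite oppr0. Qed.

Lemma iotaB a b : iota (a - b) = iota a - iota b.
Proof. by rewrite iotaD iotaN. Qed.

Lemma iotaZ l a : iota (l *: a) = l *: iota a.
Proof. by rewrite unitz_scaleE /iota /= mulr0. Qed.

Lemma iota_star a : iota (star a) = ustar S (iota a).
Proof. by rewrite /= /uadj /iota /= rmorph0. Qed.

Lemma unorm_iota a : unorm S (iota a) = rnorm a.
Proof. exact: unitz_norm_iota. Qed.

Lemma iota_fst u : u.2 = 0 -> u = iota u.1.
Proof. by case: u => a l /= ->. Qed.

Lemma iota_mulr a u : iota a * u = iota (iota a * u).1.
Proof. by apply: iota_fst; rewrite unitz_mulE /= mul0r. Qed.

Lemma iota_mull a u : u * iota a = iota (u * iota a).1.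
Proof. by apply: iota_fst; rewrite unitz_mulE /= mulr0. Qed.

Lemma spectrumE a : spectrum a = sp (iota a).
Proof.
apply/seteqP; split=> l /= h [u [h1 h2]]; apply: h; exists u.
  have <- : l%:A - iota a = (- a, l) by rewrite unitz_algE; congr (_, _); rewrite ?add0r ?subr0.
  by split.
have e : l%:A - iota a = (- a, l) by rewrite unitz_algE; congr (_, _); rewrite ?add0r ?subr0.
by split; rewrite e.
Qed.

Lemma spectrum0 a : sp (iota a) 0.
Proof.
move=> [u [/(congr1 snd) /=]]; rewrite scale0r sub0r unitz_mulE /= oppr0 mul0r.
by move/eqP; rewrite eq_sym oner_eq0.
Qed.

(** Conversely to [uposM], the square root of [iota a] stays in [A]: its scalar part has square 0.
    Spectral positivity is the form in which sums and limits of positive elements are handled. *)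
Lemma cposP a : cpos a <-> upos S (iota a).
Proof.
split=> [[x _ <-]|h].
  have -> : iota (cmul x (star x)) = ustar S (iota (star x)) * iota (star x).
    by rewrite -iota_star starK -iotaM.
  exact: uposM.
have [z [sz zz _]] := upos_sqrt h.
have z2 : z.2 = 0.
  have /eqP : z.2 * z.2 = 0 by have := congr1 snd zz; rewrite unitz_mulE.
  by rewrite mulf_eq0 orbb => /eqP.
exists z.1 => //; apply: iota_inj; rewrite iotaM iota_star -(iota_fst z2) sz.
exact: zz.
Qed.

Lemma cpos_star a : cpos a -> ustar S (iota a) = iota a.
Proof. by move=> /cposP []. Qed.

Lemma cpos0 : cpos (0 : A).
Proof. by exists 0 => //; rewrite cmul0l. Qed.

Lemma cposD a b : cpos a -> cpos b -> cpos (a + b).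
Proof. by rewrite !cposP iotaD => ha hb; exact: uposD. Qed.

Lemma cposMs x : cpos (cmul x (star x)).
Proof. by exists x. Qed.

Lemma cposMl x : cpos (cmul (star x) x).
Proof. by exists (star x) => //; rewrite starK. Qed.

Lemma cpos_closed a : (forall e : R, 0 < e -> exists2 b, cpos b & rnorm (b - a) <= e) -> cpos a.
Proof.
move=> h; apply/cposP; apply: upos_closed => e e0.
have [b hb hN] := h e e0; exists (iota b); first exact/cposP.
by rewrite -iotaB unorm_iota.
Qed.

Lemma horner_alg_snd a (p : {poly R[i]}) : (horner_alg (iota a) p).2 = p.[0].
Proof.
elim/poly_ind: p => [|p c ih]; first by rewrite rmorph0 horner0.
rewrite rmorphD rmorphM /= horner_algX horner_algC unitz_algE hornerMXaddC -ih.
by [].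
Qed.

(** The scalar part of [p(iota a)] is [p.[0]], and 0 is always in the spectrum of [iota a]; hence
    these scalar parts tend to [f 0 = 0]. *)
Lemma fcalc_iota a f u : fcalc S (iota a) f u -> f 0 = 0 -> u = iota u.1.
Proof.
move=> h f0; apply: iota_fst; apply: rnorm_eq0; apply: le_anti; rewrite rnorm_ge0 andbT.
apply: (@ler0_mul_eps _ 2) => e e0; have [p [h1 h2]] := h e e0.
have k1 := h1 0 (@spectrum0 a); rewrite f0 subr0 in k1.
have k2 := unitz_norm_snd (horner_alg (iota a) p - u).
have := rnormB (p.[0]) ((horner_alg (iota a) p - u).2 : R[i]).
rewrite {1}[(_ - u).2]/= horner_alg_snd opprB addrC subrK => k3.
by apply: (le_trans k3); move: h2 => /=; lra.
Qed.

Lemma within_continuousP a f :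
  {within (spectrum a : set R[i]^o), continuous (f : R[i]^o -> R[i]^o)} <->
  continuous_sp (iota a) f.
Proof.
rewrite /continuous_sp -spectrumE; split.
  move=> /subspace_continuousP h l e hl e0.
  have e0' : 0 < e%:C :> R[i] by rewrite ltcR.
  have /cvgrPdist_le/(_ _ e0') := h l hl.
  rewrite near_withinE => /nbhs_ballP[d /= d0 hd].
  have dr : d = (complex.Re d)%:C by apply: real_complex_Re; exact/ger0_Im/ltW.
  have d0' : 0 < complex.Re d by rewrite -ltcR -dr.
  exists (complex.Re d / 2); first by rewrite divr_gt0.
  move=> m hm hlm; rewrite -lecR -rnormE; apply: hd hm.
  rewrite -ball_normE /= rnormE dr ltcR (le_lt_trans hlm) //.
  by rewrite ltr_pdivrMr // ltr_pMr // ltr1n.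
move=> h; apply/subspace_continuousP => l hl; apply/cvgrPdist_le => e e0.
have er : e = (complex.Re e)%:C by apply: real_complex_Re; exact/ger0_Im/ltW.
have e0' : 0 < complex.Re e by rewrite -ltcR -er.
have [d d0 hd] := h l _ hl e0'.
rewrite near_withinE; apply/nbhs_ballP; exists d%:C; first by rewrite /= ltcR.
move=> m; rewrite -ball_normE /= rnormE ltcR => hlm hm.
by rewrite rnormE er lecR; apply: hd hm (ltW hlm).
Qed.

Lemma C0_spectrumP a f : C0_spectrum a f <-> continuous_sp (iota a) f /\ f 0 = 0.
Proof. by split=> -[/within_continuousP h1 h2]; split. Qed.

(** Existence of a calculus, without which [cfc] would return its default value 0. *)
Lemma cfc_of_fcalc a : ustar S (iota a) = iota a -> exists Phi, is_cfc a Phi.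
Proof.
move=> sa.
pose Phi f : A := xget 0 [set y | fcalc S (iota a) f (iota y)].
have PhiE f y : fcalc S (iota a) f (iota y) -> Phi f = y.
  move=> h; apply: xget_unique => //= z hz.
  by apply: iota_inj; apply: (fcalc_uniq sa hz h).
have PhiP f : C0_spectrum a f -> fcalc S (iota a) f (iota (Phi f)).
  move=> /C0_spectrumP[fc f0].
  have [u hu] := fcalc_exists sa fc.
  have uE := fcalc_iota hu f0; rewrite uE in hu.
  by rewrite (PhiE _ _ hu).
exists Phi; split.
- move=> f g hf hg fg; apply: iota_inj.
  by apply: (fcalc_uniq sa (PhiP _ hf) (PhiP _ hg)) => l; rewrite -spectrumE; exact: fg.
- by move=> f g hf hg; apply: PhiE; rewrite iotaD; apply: fcalcD; exact: PhiP.
- by move=> c f hf; apply: PhiE; rewrite iotaZ; apply: fcalcZ; exact: PhiP.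
- by move=> f g hf hg; apply: PhiE; rewrite iotaM; apply: fcalcM; exact: PhiP.
- by move=> f hf; apply: PhiE; rewrite iota_star; apply: fcalc_star => //; exact: PhiP.
- move=> f c hf hc.
  have c0 : 0 <= c.
    by apply: le_trans (hc 0 _); rewrite ?normr_ge0 // spectrumE; exact: spectrum0.
  have cr := real_complex_Re (ger0_Im c0).
  rewrite rnormE cr lecR -unorm_iota; apply: (fcalc_norm sa (PhiP f hf)) => l hl.
  by rewrite -lecR -cr -rnormE; apply: hc; rewrite spectrumE.
- by apply: PhiE; exact: fcalc_id.
Qed.

Lemma C0_poly a (q : {poly R[i]}) : C0_spectrum a (fun l => (q * 'X).[l]).
Proof.
apply/C0_spectrumP; split; last by rewrite hornerM hornerX mulr0.
exact: (continuous_sp_horner S).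
Qed.

(** [is_cfc] speaks of functions vanishing at 0 only, so polynomials enter in the form [q * 'X]; on
    them the algebraic axioms leave no choice. *)
Lemma is_cfc_poly a Phi (q : {poly R[i]}) : is_cfc a Phi ->
  iota (Phi (fun l => (q * 'X).[l])) = horner_alg (iota a) (q * 'X).
Proof.
move=> h.
have idC : C0_spectrum a (fun l => l).
  by have := C0_poly a 1; rewrite mul1r; congr C0_spectrum; apply/funext => l; rewrite hornerX.
elim/poly_ind: q => [|q c ih].
  have -> : (fun l => (0 * 'X).[l]) = (fun l : R[i] => 0 * l).
    by apply/funext => l; rewrite !hornerE.
  by rewrite (cfcZ h 0 idC) scale0r mul0r rmorph0.
have -> : (fun l => ((q * 'X + c%:P) * 'X).[l]) =
    (fun l => ((q * 'X).[l] * l) + c * l).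
  by apply/funext => l; rewrite hornerM hornerD hornerX hornerC mulrDl.
have C1 : C0_spectrum a (fun l => (q * 'X).[l] * l).
  have := C0_poly a (q * 'X); congr C0_spectrum; apply/funext => l.
  by rewrite [LHS]hornerM hornerX.
have C2 : C0_spectrum a (fun l => c * l).
  have := C0_poly a c%:P; congr C0_spectrum; apply/funext => l.
  by rewrite [LHS]hornerM hornerX hornerC.
rewrite (cfcD h C1 C2) (cfcM h (C0_poly a q) idC) (cfcZ h c idC) (cfc_id h).
rewrite iotaD iotaM iotaZ ih mulrDl [in RHS]rmorphD.
by rewrite !rmorphM /= horner_algX horner_algC mulr_algl.
Qed.

(** Uniqueness: [cfc] selects an unspecified [Phi], but contractivity extends its forced values on
    polynomials to all of [C0_spectrum a]. *)
Lemma is_cfc_fcalc a Phi f : ustar S (iota a) = iota a -> is_cfc a Phi ->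
  C0_spectrum a f -> fcalc S (iota a) f (iota (Phi f)).
Proof.
move=> sa h hf e e0; have [fc f0] := (C0_spectrumP a f).1 hf.
have [p hp] := poly_dense sa fc (divr_gt0 e0 (ltr0n R 2)).
(* Removing the constant term costs another [e / 2], since [f 0 = 0] makes [p.[0]] that small. *)
have [q hq] : exists q, p - p.[0]%:P = q * 'X.
  have /factor_theorem[q hq] : root (p - p.[0]%:P) 0 by rewrite rootE !hornerE subrr.
  by exists q; rewrite hq subr0.
have k l : sp (iota a) l -> rnorm ((q * 'X).[l] - f l) <= e.
  move=> hl; rewrite -hq hornerD hornerN hornerC.
  have h1 := hp l hl; have h2 := hp 0 (@spectrum0 a); rewrite f0 subr0 in h2.
  rewrite addrAC (le_trans (rnormB _ _)) //; lra.
exists (q * 'X); split=> //.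
rewrite -(is_cfc_poly q h) -iotaB unorm_iota -lecR -rnormE.
have CN : C0_spectrum a (fun l => - 1 * f l).
  apply/C0_spectrumP; split; last by rewrite f0 mulr0.
  move=> l c hl c0; have [d d0 hd] := fc l c hl c0; exists d => // m hm hlm.
  by rewrite -mulrBr mulN1r rnormN hd.
have -> : Phi (fun l => (q * 'X).[l]) - Phi f =
    Phi (fun l => (q * 'X).[l] + (- 1) * f l).
  by rewrite (cfcD h (C0_poly a q) CN) (cfcZ h _ hf) scaleN1r.
apply: (cfc_contractive h) => [|l].
  apply/C0_spectrumP; split; last by rewrite hornerM hornerX f0 !mulr0 addr0.
  have [qc _] := (C0_spectrumP a _).1 (C0_poly a q).
  move=> l c hl c0; have c2 : 0 < c / 2 by rewrite divr_gt0.
  have [d d0 hd] := qc l _ hl c2; have [d' d0' hd'] := fc l _ hl c2.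
  exists (Num.min d d'); first by rewrite lt_min d0.
  move=> m hm; rewrite le_min => /andP[k1 k2].
  rewrite !mulN1r opprD addrACA -opprD.
  have := hd m hm k1; have := hd' m hm k2.
  have := rnormB ((q * 'X).[l] - (q * 'X).[m]) (f l - f m); lra.
by rewrite spectrumE => hl; rewrite mulN1r rnormE lecR k.
Qed.

Definition cut (e : R) : R[i] -> R[i] := fun l => (Num.max (complex.Re l - e) 0)%:C.

Lemma continuous_cut (e : R) : continuous (fun s : R => Num.max (s - e) 0).
Proof.
move=> s; apply: (@continuous_max R R (fun s => s - e) (fun=> 0)); last exact: cvg_cst.
by apply: cvgB; [exact: cvg_id|exact: cvg_cst].
Qed.

(** From here on [cutdown] is accessed through [fcalc] alone. *)
Lemma cutdownP a (e : R) : cpos a -> 0 <= e -> fcalc S (iota a) (cut e) (iota (cutdown a e)).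
Proof.
move=> pa e0; have sa := cpos_star pa.
have hc : C0_spectrum a (cut e).
  apply/C0_spectrumP; split; last by rewrite /cut /= sub0r max_r // oppr_le0.
  exact: (continuous_sp_real (@continuous_cut e)).
have [Phi hPhi] := cfc_of_fcalc sa.
have : [set b | exists Phi, is_cfc a Phi /\ b = Phi (cut e)] (cutdown a e).
  by apply: (@xgetPex _ (0 : A)); exists (Phi (cut e)), Phi.
by move=> [Psi [hPsi ->]]; exact: is_cfc_fcalc.
Qed.

End Embedding.

(** * Cutdowns *)

Section Conjugation.
Context {R : realType} {B : algType R[i]} (S : ucstar B).
Implicit Types (x y : B) (l : R[i]) (g : R[i] -> R[i]).

Local Notation N := (unorm S).
Local Notation st := (ustar S).

Lemma fcalc_conj x g y : fcalc S (st x * x) g y ->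
  fcalc S (x * st x) (fun l => l * g l) (x * y * st x).
Proof.
move=> h e e0; have x0 := unorm_ge0 S x.
have D0 : 0 < N x * N x + 1 by rewrite ltr_pwDr // mulr_ge0.
have c0 : 0 < e / (N x * N x + 1) by rewrite divr_gt0.
have ce : e / (N x * N x + 1) * (N x * N x + 1) = e by rewrite divfK // lt0r_neq0.
have [p [h1 h2]] := h _ c0; move: h1 h2 c0 ce; set c := e / _ => h1 h2 c0 ce.
exists ('X * p); split=> [l hl|].
  rewrite hornerM hornerX -mulrBr rnormM.
  have [->|l0] := eqVneq l 0; first by rewrite rnorm0 mul0r ltW.
  have := usp_norm S hl; have := unormM S x (st x); rewrite unorm_star => k1 k2.
  have := h1 l (usp_mulC l0 hl); have := rnorm_ge0 (p.[l] - g l); have := rnorm_ge0 l.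
  by nra.
have -> : horner_alg (x * st x) ('X * p) = x * horner_alg (st x * x) p * st x.
  elim/poly_ind: p {h1 h2} => [|p d ih]; first by rewrite mulr0 !rmorph0 mulr0 mul0r.
  rewrite mulrDr mulrA !rmorphD /= rmorphM /= ih !rmorphM /= !horner_algX !horner_algC.
  by rewrite mulrDr mulrDl !mulrA mulr_algr mulr_algr -scalerAl.
rewrite -mulrBl -mulrBr (le_trans (unormM _ _ _)) // unorm_star.
apply: (@le_trans _ _ (N x * c * N x)); last by nra.
by rewrite ler_wpM2r // (le_trans (unormM _ _ _)) // ler_wpM2l.
Qed.

End Conjugation.

Section Cutdown.
Context {R : realType} {A : cstarAlgType R}.
Implicit Types (a b x y v w : A) (e d : R) (l : R[i]).

Local Notation S := (unitz_ucstar A).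
Local Notation sp := (@usp R (unitz A)).

Lemma sp_cpos a l : cpos a -> sp (iota a) l ->
  l = (complex.Re l)%:C /\ 0 <= complex.Re l.
Proof. by move=> /cposP[sa ha] hl; split; [exact: (usp_real sa hl)|exact: ha]. Qed.

Lemma cpos_cutdown a e : cpos a -> 0 <= e -> cpos (cutdown a e).
Proof.
move=> pa e0; apply/cposP; apply: (fcalc_pos (cpos_star pa) (cutdownP pa e0)) => l _.
by split=> //=; rewrite le_max lexx orbT.
Qed.

Lemma cle_cutdown a e : cpos a -> 0 <= e -> cle (cutdown a e) a.
Proof.
move=> pa e0; apply/cposP; rewrite iotaB.
have h := fcalcB (fcalc_id S (iota a)) (cutdownP pa e0).
apply: (fcalc_pos (cpos_star pa) h) => l hl; have [-> l0] := sp_cpos pa hl.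
rewrite /= subrr; split=> //.
by rewrite subr_ge0 ge_max l0 andbT gerBl.
Qed.

Lemma cutdown_dist a e : cpos a -> 0 <= e -> rnorm (a - cutdown a e) <= e.
Proof.
move=> pa e0; rewrite -unorm_iota iotaB.
have h := fcalcB (fcalc_id S (iota a)) (cutdownP pa e0).
apply: (fcalc_norm (cpos_star pa) h) => l hl; have [-> l0] := sp_cpos pa hl.
rewrite /cut -rmorphB /= rnorm_real.
case: (leP (complex.Re l - e) 0) => k; last by rewrite opprB addrC subrK ger0_norm.
by rewrite subr0 ger0_norm //; lra.
Qed.

Lemma cutdown_cutdown a e d : cpos a -> 0 <= e -> 0 <= d ->
  cutdown (cutdown a e) d = cutdown a (e + d).
Proof.
move=> pa e0 d0; apply: iota_inj.
have h := fcalc_comp (cutdownP pa e0) (cutdownP (cpos_cutdown pa e0) d0).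
apply: (fcalc_uniq (cpos_star pa) h (cutdownP pa (addr_ge0 e0 d0))) => l _.
rewrite /cut /=; congr (_%:C).
case: (leP (complex.Re l - e) 0) => k; last by rewrite opprD addrA.
by rewrite sub0r !max_r //; lra.
Qed.

Lemma cpos_sqrt a : cpos a -> exists x, star x = x /\ cmul x x = a.
Proof.
move=> /cposP pa; have [z [sz zz hz]] := upos_sqrt pa.
have zE : z = iota z.1.
  by apply: (fcalc_iota hz); rewrite /= maxxx sqrtr0.
exists z.1; split; apply: iota_inj; first by rewrite iota_star -zE.
by rewrite iotaM -zE.
Qed.

Lemma continuous_ratio e d : 0 < d ->
  continuous (fun s : R => Num.max (s - e) 0 / Num.max (s - d) d).
Proof.
move=> d0 s.
apply: (@continuousM R R (fun s => Num.max (s - e) 0) (fun s => (Num.max (s - d) d)^-1)).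
  exact: (@continuous_cut R e).
apply: continuousV; first by rewrite lt0r_neq0 // lt_max d0 orbT.
apply: (@continuous_max R R (fun s => s - d) (fun=> d)); last exact: cvg_cst.
by apply: cvgB; [exact: cvg_id|exact: cvg_cst].
Qed.

Lemma fcalc_real_exists (phi : R -> R) a : cpos a -> continuous phi ->
  exists u, ustar S u = u /\ fcalc S (iota a) (fun l => (phi (complex.Re l))%:C) u.
Proof.
move=> pa hphi; have sa := cpos_star pa.
have [u hu] := fcalc_exists sa (continuous_sp_real (b := iota a) hphi).
by exists u; split=> //; apply: (fcalc_sa sa hu).
Qed.

(* [(v v^* - e)_+] and [(v^* v - e)_+] are related by [w = v h(v^* v)], where
   [s h(s)^2 = (s - e)_+]. *)
Lemma cutdown_polar v e : 0 < e -> exists w,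
  cmul w (star w) = cutdown (cmul v (star v)) e /\
  cmul (star w) w = cutdown (cmul (star v) v) e.
Proof.
move=> e0; have pa := cposMl v; have pb := cposMs v.
(* The square of the function called [h] above. The denominator agrees with [s] wherever the
   numerator is nonzero, and stays at least [e], so the quotient is continuous. *)
pose rho (s : R) := Num.max (s - e) 0 / Num.max s e.
have rho0 s : 0 <= rho s.
  by rewrite divr_ge0 // le_max ?lexx ?orbT // (ltW e0) orbT.
have rhoM s : s * rho s = Num.max (s - e) 0 \/ s < 0.
  have [s0|] := leP 0 s; [left|by right]; rewrite /rho.
  case: (leP (s - e) 0) => k; first by rewrite mul0r mulr0.
  rewrite max_l; last by lra.
  by rewrite mulrC divfK // lt0r_neq0 //; lra.
have crho : continuous rho.
  move=> s.
  apply: (@continuousM R R (fun s => Num.max (s - e) 0) (fun s => (Num.max s e)^-1)).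
    exact: (@continuous_cut R e).
  apply: continuousV; first by rewrite lt0r_neq0 // lt_max e0 orbT.
  by apply: (@continuous_max R R id (fun=> e)); [exact: cvg_id|exact: cvg_cst].
have csq : continuous (fun s => Num.sqrt (rho s)).
  move=> s; apply: (@continuous_comp _ _ _ rho Num.sqrt); first exact: crho.
  exact: sqrt_continuous.
have [h [sh hh]] := fcalc_real_exists pa csq.
pose w := (iota v * h).1.
have wE : iota w = iota v * h by rewrite /w -iota_mulr.
have key a l : cpos a -> sp (iota a) l ->
    l * ((Num.sqrt (rho (complex.Re l)))%:C * (Num.sqrt (rho (complex.Re l)))%:C) = cut e l.
  move=> pa' hl; have [lr l0] := sp_cpos pa' hl.
  rewrite {1}lr /cut -!rmorphM /= -expr2 sqr_sqrtr //; congr (_%:C).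
  by have [] := rhoM (complex.Re l) => //; lra.
exists w; split; apply: iota_inj; rewrite iotaM iota_star wE ustarM sh.
  have -> : iota v * h * (h * ustar S (iota v)) = iota v * (h * h) * ustar S (iota v).
    by rewrite !mulrA.
  have := hh; rewrite iotaM iota_star => hh'.
  have := fcalc_conj (fcalcM hh' hh'); rewrite -iota_star -iotaM => k.
  apply: (fcalc_uniq (cpos_star pb) k (cutdownP pb (ltW e0))) => l hl.
  exact: key pb hl.
have -> : h * ustar S (iota v) * (iota v * h) = h * iota (cmul (star v) v) * h.
  by rewrite iotaM iota_star !mulrA.
have k := fcalcM (fcalcM hh (fcalc_id S _)) hh.
apply: (fcalc_uniq (cpos_star pa) k (cutdownP pa (ltW e0))) => l hl.
by rewrite -(key _ l pa hl) /=; ring.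
Qed.

(* With [h^2 (s - e) = (s - 2 e)_+] and [h <= 1], compressing
   [x - e <= y = v v^*] by [h = h(x)] gives [(x - 2 e)_+ <= h y h]. *)
Lemma cutdown_near x v e : cpos x -> 0 < e -> rnorm (cmul v (star v) - x) <= e ->
  exists w, cle (cutdown x (2 * e)) (cmul w (star w)) /\
            cle (cmul (star w) w) (cmul (star v) v).
Proof.
move=> px e0 hN; set y := cmul v (star v) in hN.
have e2 : 0 <= 2 * e by lra.
(* The denominator is [s - e] wherever the numerator is nonzero, namely for [s > 2 * e], and never
   drops below [e]. *)
pose rho (s : R) := Num.max (s - 2 * e) 0 / Num.max (s - e) e.
have den s : 0 < Num.max (s - e) e by rewrite lt_max e0 orbT.
have rho0 s : 0 <= rho s by rewrite divr_ge0 ?(ltW (den s)) // le_max lexx orbT.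
have rho1 s : 0 <= 1 - rho s.
  rewrite subr_ge0 ler_pdivrMr // mul1r ge_max (ltW (den s)) andbT.
  by rewrite le_max; apply/orP; left; lra.
have rhoM s : rho s * (s - e) = Num.max (s - 2 * e) 0.
  rewrite /rho; case: (leP (s - 2 * e) 0) => k; first by rewrite !mul0r.
  rewrite max_l; last by lra.
  by rewrite divfK // lt0r_neq0 //; lra.
have crho : continuous rho by exact: continuous_ratio.
have [h [sh hh]] : exists u, ustar S u = u /\
    fcalc S (iota x) (fun l => (Num.sqrt (rho (complex.Re l)))%:C) u.
  apply: (@fcalc_real_exists (fun s => Num.sqrt (rho s))) => // s.
  apply: (@continuous_comp _ _ _ rho Num.sqrt); first exact: crho.
  exact: sqrt_continuous.
(* A square root of [1 - h * h]: it writes [v^* v - w^* w] as the positive element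
   [(g v)^* (g v)]. *)
have [g [sg hg]] : exists u, ustar S u = u /\
    fcalc S (iota x) (fun l => (Num.sqrt (1 - rho (complex.Re l)))%:C) u.
  apply: (@fcalc_real_exists (fun s => Num.sqrt (1 - rho s))) => // s.
  apply: (@continuous_comp _ _ _ (fun s => 1 - rho s) Num.sqrt).
    by apply: cvgB; [exact: cvg_cst|exact: crho].
  exact: sqrt_continuous.
have gg : g * g = 1 - h * h.
  have k := fcalcB (fcalc_cst S (iota x) 1) (fcalcM hh hh).
  rewrite scale1r in k.
  apply: (fcalc_uniq (cpos_star px) (fcalcM hg hg) k) => l _.
  by rewrite -!rmorphM /= -!expr2 !sqr_sqrtr // rmorphB.
have hxh : iota (cutdown x (2 * e)) = h * iota x * h - e%:C *: (h * h).
  have k := fcalcB (fcalcM (fcalcM hh (fcalc_id S _)) hh) (fcalcZ e%:C (fcalcM hh hh)).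
  apply: (fcalc_uniq (cpos_star px) (cutdownP px e2) k) => l hl.
  have [lr l0] := sp_cpos px hl; rewrite /= [X in _ * X * _]lr -!rmorphM -rmorphB /cut /=.
  congr (_%:C); rewrite -rhoM -{1}(sqr_sqrtr (rho0 (complex.Re l))); ring.
pose w := (h * iota v).1.
have wE : iota w = h * iota v by rewrite /w -iota_mull.
exists w; split; apply/cposP; rewrite iotaB.
  rewrite (iotaM w) (iota_star w) wE ustarM sh.
  (* The norm criterion with [s = e] gives [y - x + e >= 0]; compressing its square root [m] by [h]
     shows that the difference to be bounded is [st (m * h) * (m * h)]. *)
  have pk : upos S (iota (y - x) + e%:C%:A).
    apply: (@upos_of_norm _ _ S _ e).
      rewrite ustarD ustar_alg -iota_star; congr (iota _ + _); last first.
        by congr (_ *: _); exact: conjc_real.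
      apply: iota_inj; rewrite iota_star iotaB ustarB.
      by rewrite (cpos_star (cposMs v)) (cpos_star px).
    by rewrite opprD addrCA subrr addr0 unormN unorm_iota.
  have [m [sm mm _]] := upos_sqrt pk.
  have -> : h * iota v * (ustar S (iota v) * h) - iota (cutdown x (2 * e)) =
      ustar S (m * h) * (m * h).
    have -> : ustar S (m * h) * (m * h) = h * (m * m) * h.
      by rewrite ustarM sm sh !mulrA.
    rewrite mm hxh iotaB mulrDr mulrBr mulrDl mulrBl mulr_algr -scalerAl.
    rewrite opprB [e%:C *: _ - _]addrC addrA.
    by rewrite /y iotaM iota_star !mulrA.
  exact: uposM.
rewrite (iotaM (star w)) (iota_star w) wE ustarM sh.
have -> : iota (cmul (star v) v) - ustar S (iota v) * h * (h * iota v) =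
    ustar S (g * iota v) * (g * iota v).
  have -> : ustar S (g * iota v) * (g * iota v) = ustar S (iota v) * (g * g) * iota v.
    by rewrite ustarM sg !mulrA.
  by rewrite gg mulrBr mulrBl mulr1 iotaM iota_star !mulrA.
exact: uposM.
Qed.

End Cutdown.

(** * Traces *)

Section Traces.
Context {R : realType} {A : cstarAlgType R}.
Implicit Types (a b x y v w z : A) (U : set A) (t : A -> \bar R).

Lemma norm_openP U : U `<=` cpos ->
  norm_open U <-> forall x, U x -> exists2 d : R, 0 < d &
    forall y, cpos y -> rnorm (x - y) <= d -> U y.
Proof.
move=> hU; rewrite /norm_open openE /interior.
have nbE x : cpos x ->
    nbhs (x : subspace (@cpos R A)) U = within (@cpos R A) (nbhs x) U.
  by move=> px; rewrite nbhs_subspace_in.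
split.
  move=> h x Ux; have px := hU x Ux.
  have : nbhs (x : subspace (@cpos R A)) U by exact: h.
  rewrite nbE // => /nbhs_ballP[d /= d0 hd].
  have dr : d = (complex.Re d)%:C by apply: real_complex_Re; exact/ger0_Im/ltW.
  have d0' : 0 < complex.Re d by rewrite -ltcR -dr.
  exists (complex.Re d / 2); first by rewrite divr_gt0.
  move=> y py hxy; apply: hd py; rewrite -ball_normE /= rnormE dr ltcR.
  by apply: (le_lt_trans hxy); rewrite ltr_pdivrMr // ltr_pMr // ltr1n.
move=> h x Ux; have px := hU x Ux; have [d d0 hd] := h x Ux.
suff : nbhs (x : subspace (@cpos R A)) U by [].
rewrite nbE //; apply/nbhs_ballP.
exists d%:C; first by rewrite /= ltcR.
move=> y; rewrite -ball_normE /= rnormE ltcR => hxy py.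
by apply: hd => //; exact: ltW.
Qed.

Lemma csim_single x : csim (cmul x (star x)) (cmul (star x) x).
Proof.
have single y (f : nat -> A) : f 0%N = y -> (forall n, f n.+1 = 0) ->
    series f @ \oo --> y.
  move=> f0 fS; apply/cvgrPdist_le => e e0; exists 1%N => // -[//|n] _ /=.
  rewrite /series /= big_nat_recl // f0 big1 ?addr0 ?subrr ?normr0 ?ltW //.
exists (fun n => if n is 0%N then x else 0); split; apply: single => // n.
  by rewrite cmul0l.
by rewrite cmul0r.
Qed.

Lemma prec_cutdown a (e : R) : cpos a -> 0 < e -> prec (cutdown a e) a.
Proof.
move=> pa e0; have pc := cpos_cutdown pa (ltW e0).
exists (cutdown a e), e; split=> //.
  have [x [sx <-]] := cpos_sqrt pc.
  by have := csim_single x; rewrite sx.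
by rewrite /cle subrr; exact: cpos0.
Qed.

Lemma monoid_hom_le t a b : (forall a, cpos a -> (0 <= t a)%E) -> monoid_hom t ->
  cpos a -> cpos b -> cle a b -> (t a <= t b)%E.
Proof.
move=> t0 [_ tD] pa pb pab; rewrite -(subrK a b) addrC tD //.
by rewrite leeDl // t0.
Qed.

Lemma lt_ereal_fin (x y : \bar R) : (0 <= x)%E -> (x < y)%E ->
  exists2 r : R, 0 <= r & x = r%:E.
Proof.
case: x => [r| |] //=; first by rewrite lee_fin => r0 _; exists r.
by move=> _; rewrite ltNge leey.
Qed.

Section SeriesTrace.
Variable t : A -> \bar R.
Hypothesis t_ge0 : forall a, cpos a -> (0 <= t a)%E.
Hypothesis t_hom : monoid_hom t.



Lemma cpos_sum (s : nat -> A) m n : (forall k, cpos (s k)) -> cpos (\sum_(m <= k < n) s k).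
Proof. by move=> h; apply: big_ind => //; [exact: cpos0|exact: cposD]. Qed.

Lemma hom_sum (s : nat -> A) n : (forall k, cpos (s k)) ->
  t (\sum_(0 <= k < n) s k) = (\sum_(0 <= k < n) t (s k))%E.
Proof.
move=> h; elim: n => [|n ih]; first by rewrite !big_nil t_hom.1.
by rewrite !big_nat_recr //= t_hom.2 ?ih //; exact: cpos_sum.
Qed.

Lemma cvg_rnorm (u : nat -> A) a : u @ \oo --> a -> forall e : R, 0 < e ->
  exists n, forall m, (n <= m)%N -> rnorm (a - u m) <= e.
Proof.
move=> /cvgrPdist_le h e e0; have [|n _ hn] := h e%:C; first by rewrite ltcR.
by exists n => m nm; rewrite -lecR -rnormE; exact: hn.
Qed.

(** The remainder of the series is a norm limit of finite positive sums, hence positive, and [t] is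
    monotone. *)
Lemma hom_partial_le (s : nat -> A) a n : (forall k, cpos (s k)) -> cpos a ->
  series s @ \oo --> a -> (t (\sum_(0 <= k < n) s k)%R <= t a)%E.
Proof.
move=> hs pa /cvg_rnorm h; apply: monoid_hom_le => //; first exact: cpos_sum.
apply: cpos_closed => e e0; have [m hm] := h e e0.
exists (\sum_(n <= k < n + m) s k); first exact: cpos_sum.
have := hm (n + m)%N (leq_addl _ _); rewrite rdistC /series /=.
by rewrite (big_cat_nat (n := n)) ?leq_addr //= opprB addrA [\sum_(n <= k < _) _ + _]addrC.
Qed.

(** Semicontinuity is used at [a]: some partial sum of the [x x^*] already has trace above [t b].
    Termwise this is the trace of a partial sum of the [x^* x], which monotonicity keeps below
    [t b]. *)
Lemma lsc_csim_le a b : lsc_for norm_open t ->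
  (forall x, t (cmul x (star x)) = t (cmul (star x) x)) ->
  cpos a -> cpos b -> csim a b -> (t a <= t b)%E.
Proof.
move=> tl tt pa pb [x [ha hb]]; rewrite leNgt; apply/negP => hlt.
(* Being below [t a], the value [t b] is finite and can itself serve as the threshold. *)
have [r r0 tb] := lt_ereal_fin (t_ge0 pb) hlt; rewrite tb in hlt.
have sub : cpos `&` [set a | (r%:E < t a)%E] `<=` cpos by move=> z [].
have [d d0 hd] := (norm_openP sub).1 (tl r r0) a (conj pa hlt).
have [n hn] := cvg_rnorm ha d0.
have ps1 k : cpos (cmul (x k) (star (x k))) by exact: cposMs.
have ps2 k : cpos (cmul (star (x k)) (x k)) by exact: cposMl.
have [_ /=] := hd _ (cpos_sum 0 n ps1) (hn n (leqnn n)).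
rewrite hom_sum //; under eq_bigr do rewrite tt; rewrite -hom_sum //.
by rewrite ltNge -tb (hom_partial_le n ps2 pb hb).
Qed.

Lemma trace_cspace_open : lsc_for norm_open t ->
  (forall x, t (cmul x (star x)) = t (cmul (star x) x)) -> lsc_for cspace_open t.
Proof.
move=> tl tt r r0; apply/seteqP; split=> [x [px hx]|x [px [z [pz hz]]]].
  have sub : cpos `&` [set a | (r%:E < t a)%E] `<=` cpos by move=> z [].
  have [d d0 hd] := (norm_openP sub).1 (tl r r0) x (conj px hx).
  split=> //; exists (cutdown x d); last exact: prec_cutdown.
  apply: hd; first by apply: cpos_cutdown => //; exact: ltW.
  by apply: cutdown_dist => //; exact: ltW.
move=> [a' [e [pa' e0 hs hle]]]; split=> //; apply: (lt_le_trans hz).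
have e0' := ltW e0; have pc := cpos_cutdown px e0'.
apply: (le_trans (lsc_csim_le tl tt pz pa' hs)).
apply: (le_trans (monoid_hom_le t_ge0 t_hom pa' pc hle)).
by apply: monoid_hom_le => //; exact: cle_cutdown.
Qed.

Hypothesis t_lsc : lsc_for cspace_open t.

(** Open sets of the c-space topology are upward closed for [prec]. If [t b < t a], the level set
    above [t b] would contain [a], hence [b]. *)
Lemma lsc_prec_le a b : cpos a -> cpos b -> prec a b -> (t a <= t b)%E.
Proof.
move=> pa pb ab; rewrite leNgt; apply/negP => hlt.
have [r r0 tb] := lt_ereal_fin (t_ge0 pb) hlt.
have : (cpos `&` [set a | (r%:E < t a)%E]) b.
  by rewrite (t_lsc r0); split=> //; exists a => //; split=> //=; rewrite -tb.
by move=> [_ /=]; rewrite tb ltxx.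
Qed.

Lemma lsc_cutdown x (r : R) : cpos x -> 0 <= r -> (r%:E < t x)%E ->
  exists2 e : R, 0 < e & (r%:E < t (cutdown x e))%E.
Proof.
move=> px r0 hx.
have : (cpos `&` [set a | (r%:E < t a)%E]) x by [].
rewrite (t_lsc r0) => -[_ [z [pz hz] [a' [e [pa' e0 hs hle]]]]].
have e2 : 0 < e / 2 by rewrite divr_gt0.
exists (e / 2) => //; apply: (lt_le_trans hz); apply: lsc_prec_le => //.
  exact: cpos_cutdown (ltW e2).
exists a', (e / 2); split=> //.
by rewrite cutdown_cutdown ?(ltW e2) // -splitr.
Qed.

Lemma lsc_trace_le x : (t (cmul x (star x)) <= t (cmul (star x) x))%E.
Proof.
rewrite leNgt; apply/negP => hlt; have pa := cposMs x; have pb := cposMl x.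
have [r r0 tb] := lt_ereal_fin (t_ge0 pb) hlt; rewrite tb in hlt.
have [e e0 he] := lsc_cutdown pa r0 hlt.
have [w [ww1 ww2]] := cutdown_polar x e0.
have : (t (cutdown (cmul x (star x)) e) <= t (cmul (star x) x))%E.
  apply: lsc_prec_le => //; first exact: cpos_cutdown (ltW e0).
  exists (cutdown (cmul (star x) x) e), e; split=> //.
  - exact: cpos_cutdown (ltW e0).
  - by rewrite -ww1 -ww2; exact: csim_single.
  - by rewrite /cle subrr; exact: cpos0.
by rewrite tb leNgt he.
Qed.

Lemma cspace_lsc_trace x : t (cmul x (star x)) = t (cmul (star x) x).
Proof.
apply: le_anti; rewrite lsc_trace_le.
by have := lsc_trace_le (star x); rewrite starK.
Qed.

Lemma cspace_lsc_norm_open : lsc_for norm_open t.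
Proof.
move=> r r0; have sub : cpos `&` [set a | (r%:E < t a)%E] `<=` cpos by move=> z [].
apply/(norm_openP sub) => x [px hx].
have [e e0 he] := lsc_cutdown px r0 hx.
have e2 : 0 < e / 2 by rewrite divr_gt0.
(* [cutdown_near] doubles the distance, so this radius leads to the cutdown at [e]. *)
exists (e / 2) => // y [v _ <-] hxy; split; first exact: cposMs.
have hyx : rnorm (cmul v (star v) - x) <= e / 2 by rewrite rdistC.
have [w [w1 w2]] := cutdown_near px e2 hyx.
have ee : 2 * (e / 2) = e by rewrite mulrC divfK // pnatr_eq0.
rewrite ee in w1; rewrite /= cspace_lsc_trace; apply: (lt_le_trans he).
have pc := cpos_cutdown px (ltW e0).
apply: (le_trans (monoid_hom_le t_ge0 t_hom pc (cposMs w) w1)).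
by rewrite cspace_lsc_trace; apply: monoid_hom_le w2 => //; exact: cposMl.
Qed.

End SeriesTrace.
End Traces.

Theorem lemma4p2 (R : realType) (A : cstarAlgType R) (t : A -> \bar R)
    (t_ge0 : forall a : A, cpos a -> (0 <= t a)%E) :
  lsc_trace t <-> monoid_hom t /\ lsc_for cspace_open t.
Proof.
split=> [[th tl tt]|[th tl]].
  by split=> //; exact: trace_cspace_open.
split=> //; first exact: cspace_lsc_norm_open.
exact: cspace_lsc_trace.
Qed.
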